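(* Let $\mathfrak{A}$ be a $C^*$-algebra, let $\mathscr{H},\mathscr{K}$ be Hilbert $\mathfrak{A}$-modules, and let $A,C\in\mathcal{L}(\mathscr{H},\mathscr{K})$ be such that $A$ is semi-regular. Then the system $$AX=C,\quad X\in\mathcal{L}(\mathscr{H})_+$$ has a solution if and only if $$\mathcal{R}(C)\subseteq\mathcal{R}(A)\ \text{ and }\ CC^*\le t\,CA^*\ \text{ for some } t>0.$$
   Context: For Hilbert $\mathfrak{A}$-modules $\mathscr{H},\mathscr{K}$, $\mathcal{L}(\mathscr{H},\mathscr{K})$ denotes the set of adjointable operators from $\mathscr{H}$ to $\mathscr{K}$, $\mathcal{L}(\mathscr{H})=\mathcal{L}(\mathscr{H},\mathscr{H})$ (a $C^*$-algebra), $\mathcal{L}(\mathscr{H})_+$ is the set of positive elements of $\mathcal{L}(\mathscr{H})$, and $\mathcal{R}(\cdot)$ denotes the range. For Hermitian operators $S,T$, $S\le T$ means that $T-S$ is positive; in particular the condition $CC^*\le t\,CA^*$ includes that $CA^*$ is Hermitian. A closed submodule $M$ of $\mathscr{H}$ is orthogonally complemented if $\mathscr{H}=M\oplus M^\perp$, where $M^\perp=\{x\in\mathscr{H}:\langle x,y\rangle=0 \text{ for any } y\in M\}$. An operator $A\in\mathcal{L}(\mathscr{H},\mathscr{K})$ is semi-regular if $\overline{\mathcal{R}(A)}$ and $\overline{\mathcal{R}(A^* )}$ are orthogonally complemented in $\mathscr{K}$ and $\mathscr{H}$, respectively. *)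

(* Defs.v *)
From HB Require Import structures.
From mathcomp Require Import all_boot all_order all_algebra.
From mathcomp Require Import complex.
From mathcomp Require Import boolp classical_sets reals topology normedtype.

Set Implicit Arguments.
Unset Strict Implicit.
Unset Printing Implicit Defensive.

Import Order.TTheory GRing.Theory Num.Theory.
Import numFieldNormedType.Exports.

Local Open Scope classical_set_scope.
Local Open Scope ring_scope.
Local Open Scope complex_scope.

Reserved Notation "x ** y" (at level 40, left associativity).
Reserved Notation "S *o T" (at level 40, left associativity).

(* Complex *-algebras are not assumed to have a unit, hence not built on
   MathComp's ring structures.  In [l^*], the star is complex conjugation. *)
HB.mixin Record Lmodule_isStarAlgebra (R : realType) A
    & GRing.Lmodule R[i] A := {
  smul : A -> A -> A;
  star : A -> A;
  smulA : forall a b c, smul a (smul b c) = smul (smul a b) c;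
  smulDl : forall a b c, smul (a + b) c = smul a c + smul b c;
  smulDr : forall a b c, smul a (b + c) = smul a b + smul a c;
  smulZl : forall (l : R[i]) a b, smul (l *: a) b = l *: smul a b;
  smulZr : forall (l : R[i]) a b, smul a (l *: b) = l *: smul a b;
  starD : forall a b, star (a + b) = star a + star b;
  starZ : forall (l : R[i]) a, star (l *: a) = (l^* )%R *: star a;
  starM : forall a b, star (smul a b) = smul (star b) (star a);
  starK : forall a, star (star a) = a }.

#[short(type="starAlgType")]
HB.structure Definition StarAlgebra (R : realType) :=
  { A of Lmodule_isStarAlgebra R A & GRing.Lmodule R[i] A }.

Notation "a ** b" := (smul a b) : ring_scope.

HB.mixin Record StarAlgebra_isCstar (R : realType) A
    & StarAlgebra R A & CompleteNormedModule R[i] A := {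
  cstar_normM : forall a b : A, `|a ** b| <= `|a| * `|b|;
  cstar_normE : forall a : A, `|star a ** a| = `|a| ^+ 2 }.

#[short(type="cstarAlgType")]
HB.structure Definition CstarAlgebra (R : realType) :=
  { A of StarAlgebra_isCstar R A & StarAlgebra R A
       & CompleteNormedModule R[i] A }.

Section Positive.
Variables (R : realType) (A : starAlgType R).
Implicit Type a : A.

(* [(1 - a)(1 - b) = 1 = (1 - b)(1 - a)] in the unitization of [A]; when [A]
   is unital, this says that [1 - a] is invertible in [A] itself. *)
Definition quasi_invertible a :=
  exists b : A, a + b - a ** b = 0 /\ a + b - b ** a = 0.

(* The spectrum in the unitization of [A]; it always contains 0, and when [A]
   is unital its other points are those [l] for which [l - a] is not
   invertible in [A]. *)
Definition spectrum a : set R[i] :=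
  [set l | l = 0 \/ ~ quasi_invertible (l^-1 *: a)].

Definition hermitian a := star a = a.

(* In [R[i]], [0 <= l] means that [l] is real and nonnegative. *)
Definition positive a := hermitian a /\ (forall l, spectrum a l -> 0 <= l).

Definition herm_le a b := [/\ hermitian a, hermitian b & positive (b - a)].

End Positive.

(* Hilbert modules are right modules; the inner product is linear in its
   second variable. *)
HB.mixin Record NormedModule_isHilbertModule (R : realType)
    (A : cstarAlgType R) H & CompleteNormedModule R[i] H := {
  ract : H -> A -> H;
  inner : H -> H -> A;
  ractDl : forall x y a, ract (x + y) a = ract x a + ract y a;
  ractDr : forall x a b, ract x (a + b) = ract x a + ract x b;
  ractM : forall x a b, ract x (a ** b) = ract (ract x a) b;
  ractZl : forall (l : R[i]) x a, ract (l *: x) a = l *: ract x a;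
  ractZr : forall (l : R[i]) x a, ract x (l *: a) = l *: ract x a;
  innerDr : forall x y z, inner x (y + z) = inner x y + inner x z;
  innerZr : forall (l : R[i]) x y, inner x (l *: y) = l *: inner x y;
  innerAr : forall x y a, inner x (ract y a) = inner x y ** a;
  innerC : forall x y, inner y x = star (inner x y);
  inner_ge0 : forall x, positive (inner x x);
  inner_eq0 : forall x, inner x x = 0 -> x = 0;
  hilbert_normE : forall x : H, `|x| ^+ 2 = `|inner x x| }.

#[short(type="hilbertModType")]
HB.structure Definition HilbertModule (R : realType) (A : cstarAlgType R) :=
  { H of NormedModule_isHilbertModule R A H & CompleteNormedModule R[i] H }.


Section InnerProduct.
Variables (R : realType) (A : cstarAlgType R) (H : hilbertModType A).
Implicit Types (x y z : H) (l : R[i]).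

Lemma innerDl x y z : inner (x + y) z = inner x z + inner y z.
Proof. by rewrite innerC innerDr starD -!innerC. Qed.

Lemma innerZl l x y : inner (l *: x) y = (l^* )%R *: inner x y.
Proof. by rewrite innerC innerZr starZ -innerC. Qed.

Lemma inner0l x : inner 0 x = 0.
Proof. by rewrite -(scale0r x) innerZl rmorph0 scale0r. Qed.

Lemma inner_inj x y : (forall z, inner x z = inner y z) -> x = y.
Proof.
move=> e; apply/eqP; rewrite -subr_eq0; apply/eqP; apply: inner_eq0.
by rewrite innerDl e -innerDl subrr inner0l.
Qed.

Lemma inner0r x : inner x 0 = 0.
Proof. by rewrite -(scale0r x) innerZr scale0r. Qed.

End InnerProduct.

(* The adjoint is carried as data, but it is unique: see [adjopP]. *)
Record adjop (R : realType) (A : cstarAlgType R) (H K : hilbertModType A) :=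
  Adjop {
    adjop_fun :> H -> K;
    adjop_adj : K -> H;
    adjop_adjE : forall x y,
      inner (adjop_fun x) y = inner x (adjop_adj y) }.

Section Adjointable.
Variables (R : realType) (A : cstarAlgType R).
Implicit Types H K L : hilbertModType A.

Lemma adjopP H K (S T : adjop H K) : S =1 T -> S = T.
Proof.
case: S T => [f f' fE] [g g' gE] /= fg.
have {}fg : f = g by apply/funext.
subst g; have fg' : f' = g'.
  apply/funext => y; apply: inner_inj => x.
  by rewrite innerC -fE gE -innerC.
by subst g'; congr Adjop; exact: Prop_irrelevance.
Qed.

Program Definition adj H K (T : adjop H K) : adjop K H :=
  @Adjop _ _ _ _ (adjop_adj T) T _.
Next Obligation. by move=> H K T x y; rewrite innerC -adjop_adjE -innerC. Qed.

Program Definition adjop_comp H K L (S : adjop K L) (T : adjop H K) :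
    adjop H L :=
  @Adjop _ _ _ _ (S \o T) (adj T \o adj S) _.
Next Obligation. by move=> H K L S T x y /=; rewrite !adjop_adjE. Qed.

Program Definition adjop_id H : adjop H H := @Adjop _ _ _ _ id id _.
Next Obligation. by []. Qed.

Section Lmodule.
Variables H K : hilbertModType A.
Implicit Types S T : adjop H K.

HB.instance Definition _ := gen_eqMixin (adjop H K).
HB.instance Definition _ := gen_choiceMixin (adjop H K).

Program Definition adjop_zero : adjop H K :=
  @Adjop _ _ _ _ (fun=> 0) (fun=> 0) _.
Next Obligation. by move=> x y; rewrite inner0l inner0r. Qed.

Program Definition adjop_opp T : adjop H K :=
  @Adjop _ _ _ _ (fun x => - T x) (fun y => - adj T y) _.
Next Obligation.
move=> T x y; rewrite /= -(scaleN1r (T x)) -(scaleN1r (adjop_adj T y)).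
by rewrite innerZl innerZr rmorphN1 adjop_adjE.
Qed.

Program Definition adjop_add S T : adjop H K :=
  @Adjop _ _ _ _ (fun x => S x + T x) (fun y => adj S y + adj T y) _.
Next Obligation.
by move=> S T x y; rewrite innerDl innerDr !adjop_adjE.
Qed.

Program Definition adjop_scale (l : R[i]) T : adjop H K :=
  @Adjop _ _ _ _ (fun x => l *: T x) (fun y => (l^* )%R *: adj T y) _.
Next Obligation. by move=> l T x y; rewrite innerZl innerZr adjop_adjE. Qed.

Let addA : associative adjop_add.
Proof. by move=> S T U; apply: adjopP => x /=; rewrite addrA. Qed.
Let addC : commutative adjop_add.
Proof. by move=> S T; apply: adjopP => x /=; rewrite addrC. Qed.
Let add0 : left_id adjop_zero adjop_add.
Proof. by move=> T; apply: adjopP => x /=; rewrite add0r. Qed.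
Let addN : left_inverse adjop_zero adjop_opp adjop_add.
Proof. by move=> T; apply: adjopP => x /=; rewrite addNr. Qed.

HB.instance Definition _ := GRing.isZmodule.Build (adjop H K)
  addA addC add0 addN.

Let scaleA (k l : R[i]) T :
  adjop_scale k (adjop_scale l T) = adjop_scale (k * l) T.
Proof. by apply: adjopP => x /=; rewrite scalerA. Qed.
Let scale1 : left_id 1 adjop_scale.
Proof. by move=> T; apply: adjopP => x /=; rewrite scale1r. Qed.
Let scaleDr : right_distributive adjop_scale +%R.
Proof. by move=> l S T; apply: adjopP => x /=; rewrite scalerDr. Qed.
Let scaleDl T : {morph adjop_scale^~ T : k l / k + l}.
Proof. by move=> k l; apply: adjopP => x /=; rewrite scalerDl. Qed.

HB.instance Definition _ := GRing.Zmodule_isLmodule.Build R[i] (adjop H K)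
  scaleA scale1 scaleDr scaleDl.

End Lmodule.

Lemma adjop_is_additive H K (T : adjop H K) x y : T (x + y) = T x + T y.
Proof. by apply: inner_inj => z; rewrite innerDl !adjop_adjE innerDl. Qed.

Lemma adjop_is_scalable H K (T : adjop H K) (l : R[i]) x :
  T (l *: x) = l *: T x.
Proof. by apply: inner_inj => z; rewrite innerZl !adjop_adjE innerZl. Qed.

Section StarAlgebra.
Variable H : hilbertModType A.
Local Notation LH := (adjop H H).

Let compA (S T U : LH) :
  adjop_comp S (adjop_comp T U) = adjop_comp (adjop_comp S T) U.
Proof. by apply: adjopP. Qed.
Let compDl (S T U : LH) :
  adjop_comp (S + T) U = adjop_comp S U + adjop_comp T U.
Proof. by apply: adjopP. Qed.
Let compDr (S T U : LH) :
  adjop_comp S (T + U) = adjop_comp S T + adjop_comp S U.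
Proof. by apply: adjopP => x /=; rewrite adjop_is_additive. Qed.
Let compZl (l : R[i]) (S T : LH) :
  adjop_comp (l *: S) T = l *: adjop_comp S T.
Proof. by apply: adjopP. Qed.
Let compZr (l : R[i]) (S T : LH) :
  adjop_comp S (l *: T) = l *: adjop_comp S T.
Proof. by apply: adjopP => x /=; rewrite adjop_is_scalable. Qed.
Let adjD (S T : LH) : adj (S + T) = adj S + adj T.
Proof. by apply: adjopP. Qed.
Let adjZ (l : R[i]) (T : LH) : adj (l *: T) = (l^* )%R *: adj T.
Proof. by apply: adjopP. Qed.
Let adjM (S T : LH) : adj (adjop_comp S T) = adjop_comp (adj T) (adj S).
Proof. by apply: adjopP. Qed.
Let adjK (T : LH) : adj (adj T) = T.
Proof. by apply: adjopP. Qed.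

HB.instance Definition _ := Lmodule_isStarAlgebra.Build R (adjop H H)
  compA compDl compDr compZl compZr adjD adjZ adjM adjK.

Let quasiE (a b : LH) :
  (a + b - a ** b = 0) <->
  (adjop_id H - a) ** (adjop_id H - b) = adjop_id H.
Proof.
have -> : (adjop_id H - a) ** (adjop_id H - b)
    = adjop_id H - (a + b - a ** b).
  apply: adjopP => x /=.
  rewrite -(scaleN1r (b x)) adjop_is_additive adjop_is_scalable !scaleN1r.
  by rewrite !opprD !opprK -!addrA; congr (_ + _); rewrite addrCA.
split=> [->|e]; first by rewrite subr0.
by apply/eqP; rewrite -oppr_eq0 -(addKr (adjop_id H) (- _)) e addNr.
Qed.

(* [spectrum] agrees away from 0 with the usual spectrum in the unital algebra
   of adjointable operators on [H]. *)
Lemma spectrum_adjop (T : LH) (l : R[i]) : l != 0 ->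
  spectrum T l <-> ~ (exists S : LH,
    S ** (l *: adjop_id H - T) = adjop_id H /\
    (l *: adjop_id H - T) ** S = adjop_id H).
Proof.
move=> l0; set I := adjop_id H; set U := l *: I - T.
have UE : U = l *: (I - l^-1 *: T).
  by rewrite scalerBr scalerA divff // scale1r.
have qE : quasi_invertible (l^-1 *: T) <->
    exists S : LH, S ** U = I /\ U ** S = I.
  split=> [[b [/quasiE e1]]|[S [e1 e2]]].
    rewrite [X in X - _]addrC => /quasiE e2.
    exists (l^-1 *: (I - b)); rewrite UE !smulZl !smulZr !scalerA.
    by rewrite divff // mulVf // !scale1r.
  exists (I - l *: S); rewrite [X in _ /\ X - _ = _]addrC.
  have IK : I - (I - l *: S) = l *: S by rewrite opprB addrC subrK.
  split; apply/quasiE; rewrite -/I IK.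
    by rewrite smulZr -smulZl -UE.
  by rewrite smulZl -smulZr -UE.
split; first by case=> [l_0|nq /qE //]; rewrite l_0 eqxx in l0.
by move=> n; right => /qE.
Qed.

End StarAlgebra.

End Adjointable.

Notation "S *o T" := (adjop_comp S T) : ring_scope.

Section Complemented.
Variables (R : realType) (A : cstarAlgType R).

Definition orthocomp (H : hilbertModType A) (M : set H) : set H :=
  [set x | forall y, M y -> inner x y = 0].

Definition orthogonally_complemented (H : hilbertModType A) (M : set H) :=
  (forall x, exists y z, [/\ M y, orthocomp M z & x = y + z]) /\
  M `&` orthocomp M = [set 0].

Definition semi_regular (H K : hilbertModType A) (T : adjop H K) :=
  orthogonally_complemented (closure (range T)) /\
  orthogonally_complemented (closure (range (adj T))).

End Complemented.

(* Main.v *)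
Require Import Defs.
From mathcomp Require Import all_boot all_order all_algebra.
From mathcomp Require Import complex ring lra.
From mathcomp Require Import boolp classical_sets reals topology normedtype.
From mathcomp Require Import sequences.

Import Order.TTheory GRing.Theory Num.Theory.
Import numFieldNormedType.Exports.

Local Open Scope classical_set_scope.
Local Open Scope ring_scope.
Local Open Scope complex_scope.

Set Implicit Arguments.
Unset Strict Implicit.
Unset Printing Implicit Defensive.

(** The theorem reduces to a short computation with forms once positivity in
    the sense of the spectrum is known to be equivalent, for a self-adjoint
    operator T on a Hilbert module, to the positivity of [inner x (T x)] in the
    algebra for all x ([positive_form_pos], [form_pos_positive]).

    Necessity.  If AX = C with X positive and t bounds the norm of X, then
    t CA* - CC* = A (tX - X^2) A*, so its form at y is the form of X (t - X) at
    A* y.  This is positive because t X (t - X) is the sum of X (t - X) X and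
    (t - X) X (t - X) ([form_pos_logistic]).

    Sufficiency.  Let M be the closure of the range of A* and P the orthogonal
    projection onto M.  Since A vanishes on the complement of M, the inclusion
    of ranges yields for each x a point D x of M with A (D x) = C x.  The
    inequality CC* <= t CA* says that |C* y| <= t |A* y|, so A* y |-> C* y
    extends continuously to M; extended by zero on the complement of M it is an
    adjoint of D ([reduced_solution]).  The compression of D to M is
    self-adjoint and satisfies DD* <= t D there, first on the range of A* and
    then on M by continuity.  With Q = 1 - P put
      X = D + Q D* + t Q.
    Then AX = AD = C, X is self-adjoint, and
      t X = P (t D - D D* ) P + (D + t Q) (D + t Q)*
    shows that X is positive ([solvable_sufficient]).

    The equivalence between the two notions of positivity rests on some order
    theory of C*-algebras, developed without a continuous functional calculus
    and without the spectral radius formula.  The setting is a Banach space V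
    with a sesquilinear form whose values have norm at most |x| |y|, with
    equality on the diagonal ([inner_form]); it covers the algebra itself, with
    star a ** b, and every Hilbert module.  A symmetric map f is called
    accretive if |s - f| <= s for some real s.  Only two analytic tools are
    used: the square root of 1 - h for |h| < 1, obtained by iteration
    ([sqrt_one_minus]), and the fact that |f^2 + g^2| bounds |f|^2 when f and g
    commute, by the C*-identity for f + ig ([sumsq_bound]).  They show that
    accretive maps form a closed cone containing all squares and the products of
    commuting members, that -c <= g <= c implies |g| <= c ([bnd_interval]), and
    that f is accretive as soon as f + l is invertible for all l > 0
    ([accretive_of_shifts]).  Applied to left multiplications this gives the
    cone [pos] of the algebra and the Cauchy-Schwarz inequality
    ([inner_norm_le]), which makes the theory available on Hilbert modules. *)

(** * Linear identities in modules

    Both sides are reified as formal linear combinations of atoms, which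
    reduces the identity to equalities of scalar coefficients. *)

Section LinearExpressions.
Variables (K : comPzRingType) (V : lmodType K).

Inductive lexpr :=
  | LZero | LVar of nat | LAdd of lexpr & lexpr | LOpp of lexpr
  | LScale of K & lexpr.

Fixpoint leval (env : seq V) (e : lexpr) : V :=
  match e with
  | LZero => 0
  | LVar i => nth 0 env i
  | LAdd e1 e2 => leval env e1 + leval env e2
  | LOpp e1 => - leval env e1
  | LScale k e1 => k *: leval env e1
  end.

Fixpoint lcoef (i : nat) (e : lexpr) : K :=
  match e with
  | LZero => 0
  | LVar j => if Nat.eqb i j then 1 else 0
  | LAdd e1 e2 => lcoef i e1 + lcoef i e2
  | LOpp e1 => - lcoef i e1
  | LScale k e1 => k * lcoef i e1
  end.

Fixpoint lcoefs_eq (n : nat) (e1 e2 : lexpr) : Prop :=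
  match n with
  | 0%N => True
  | m.+1 => lcoef m e1 = lcoef m e2 /\ lcoefs_eq m e1 e2
  end.

Lemma leval_sum env e :
  leval env e = \sum_(i < size env) lcoef i e *: nth 0 env i.
Proof.
elim: e => [|j|e1 IH1 e2 IH2|e1 IH1|k e1 IH1] /=.
- by rewrite big1 // => i _; rewrite scale0r.
- have [lt_j|ge_j] := ltnP j (size env).
    rewrite (bigD1 (Ordinal lt_j)) //= PeanoNat.Nat.eqb_refl scale1r.
    rewrite big1 ?addr0 // => i; rewrite -val_eqE /= => /eqP ne_ij.
    by move/PeanoNat.Nat.eqb_neq: ne_ij => ->; rewrite scale0r.
  rewrite nth_default // big1 // => i _.
  have /PeanoNat.Nat.eqb_neq -> : nat_of_ord i <> j.
    by move=> e; move: (ltn_ord i); rewrite e ltnNge ge_j.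
  by rewrite scale0r.
- by rewrite IH1 IH2 -big_split; apply: eq_bigr => i _; rewrite scalerDl.
- by rewrite IH1 -sumrN; apply: eq_bigr => i _; rewrite scaleNr.
- by rewrite IH1 scaler_sumr; apply: eq_bigr => i _; rewrite scalerA.
Qed.

Lemma leval_eq env e1 e2 :
  lcoefs_eq (size env) e1 e2 -> leval env e1 = leval env e2.
Proof.
move=> h; rewrite !leval_sum; apply: eq_bigr => i _; congr (_ *: _).
case: i => i /=; elim: (size env) h => //= n IH [e h].
by rewrite ltnS leq_eqVlt => /orP[/eqP -> //|]; apply: IH.
Qed.

End LinearExpressions.

(* Fails when [x] does not occur, which [latoms] uses as a membership test. *)
Ltac lindex x env :=
  lazymatch env with
  | x :: _ => constr:(0%N)
  | _ :: ?env' => let n := lindex x env' in constr:(S n)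
  end.

Ltac latoms t env :=
  lazymatch t with
  | (?a + ?b)%R => let env := latoms a env in latoms b env
  | (- ?a)%R => latoms a env
  | (_ *: ?a)%R => latoms a env
  | 0%R => env
  | _ =>
    match env with
    | _ => let n := lindex t env in env
    | _ => constr:(t :: env)
    end
  end.

Ltac lreify K t env :=
  lazymatch t with
  | (?a + ?b)%R =>
      let a := lreify K a env in let b := lreify K b env in
      constr:(@LAdd K a b)
  | (- ?a)%R => let a := lreify K a env in constr:(@LOpp K a)
  | (?k *: ?a)%R => let a := lreify K a env in constr:(@LScale K k a)
  | 0%R => constr:(@LZero K)
  | _ => let n := lindex t env in constr:(@LVar K n)
  end.

Ltac lmodule_eq K :=
  lazymatch goal with
  | |- @eq ?V ?a ?b =>
    let env := latoms a (@nil V) in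
    let env := latoms b env in
    let ea := lreify K a env in
    let eb := lreify K b env in
    refine (@leval_eq K _ env ea eb _);
    cbn [size lcoefs_eq lcoef Nat.eqb]; repeat split
  end.

(** * Real-valued norms and geometric convergence *)

Section RealNorm.
Variable R : realType.

Section Norm.
Variable V : normedModType R[i].

(** The norm of a module over R[i] is itself an element of R[i]; its real part
    lives in an ordered field, where inequalities can be decided. *)
Definition nm (x : V) : R := complex.Re `|x|.

Lemma nmE x : `|x| = (nm x)%:C.
Proof. by rewrite /nm RRe_real // ger0_real. Qed.

Lemma nm_ge0 x : 0 <= nm x.
Proof. by rewrite -ler0c -nmE. Qed.

Lemma nmD x y : nm (x + y) <= nm x + nm y.
Proof.
by rewrite -lecR (_ : (_ + _)%:C = `|x| + `|y|) -?nmE ?ler_normD // !nmE -rmorphD.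
Qed.

Lemma nmN x : nm (- x) = nm x.
Proof. by rewrite /nm normrN. Qed.

Lemma nmB x y : nm (x - y) <= nm x + nm y.
Proof. by rewrite -(nmN y); exact: nmD. Qed.

Lemma nm_distC x y : nm (x - y) = nm (y - x).
Proof. by rewrite -nmN opprB. Qed.

Lemma nm0 : nm 0 = 0.
Proof. by rewrite /nm normr0. Qed.

Lemma nm_le0 x : nm x <= 0 -> x = 0.
Proof.
move=> h; apply/eqP; rewrite -normr_eq0 nmE.
by have -> : nm x = 0 by apply/eqP; rewrite eq_le h nm_ge0.
Qed.

Lemma nmZ (t : R) x : nm (t%:C *: x) = `|t| * nm x.
Proof.
apply: (@complexI R).
rewrite -nmE normrZ nmE rmorphM; congr (_ * _).
by rewrite normc_def /= expr0n addr0 sqrtr_sqr.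
Qed.

End Norm.

End RealNorm.

Section GeometricLimits.
Variable R : realType.

Lemma geo_small (c r e : R) : 0 <= r -> r < 1 -> 0 < e ->
  exists n, c * r ^+ n < e.
Proof.
move=> r0 r1 e0.
have ce : 0 < e / (`|c| + 1) by rewrite divr_gt0 // ltr_wpDl.
have := @cvg_expr R r; rewrite ger0_norm // => /(_ r1) /cvgr0_norm_lt /(_ _ ce).
move=> [N _ /(_ N (leqnn N))] /=; rewrite ger0_norm ?exprn_ge0 // => h.
exists N; apply: le_lt_trans (ler_norm _) _.
rewrite normrM (ger0_norm (exprn_ge0 N r0)).
move: h; rewrite ltr_pdivlMr ?ltr_wpDl // => h.
have := exprn_ge0 N r0; nra.
Qed.

Lemma geo_le0 (v c r : R) : 0 <= r -> r < 1 ->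
  (forall n, v <= c * r ^+ n) -> v <= 0.
Proof.
move=> r0 r1 h; rewrite leNgt; apply/negP => v0.
by have [n] := geo_small c r0 r1 v0; rewrite ltNge h.
Qed.

Lemma le_eps (a b k : R) :
  (forall e, 0 < e -> e <= 1 -> a <= b + e * k) -> a <= b.
Proof.
move=> h; rewrite leNgt; apply/negP => lt_ba.
pose e := Order.min 1 ((a - b) / (2 * (`|k| + 1))).
have k0 : 0 < 2 * (`|k| + 1) by rewrite mulr_gt0 // ltr_wpDl.
have e0 : 0 < e by rewrite lt_min ltr01 divr_gt0 // subr_gt0.
have e1 : e <= 1 by rewrite ge_min lexx.
have : e <= (a - b) / (2 * (`|k| + 1)) by rewrite ge_min lexx orbT.
rewrite ler_pdivlMr // => he.
have := h _ e0 e1; have := ler_norm k; nra.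
Qed.

(** All vectors and operators constructed by iteration below are geometric
    limits; this form of completeness also gives the speed of convergence, from
    which identities pass to the limit by [geo_le0]. *)
Lemma geometric_cvg (V : completeNormedModType R[i]) (u : nat -> V) (c r : R) :
  0 <= r -> r < 1 -> (forall n, nm (u n.+1 - u n) <= c * r ^+ n) ->
  exists l, forall n, nm (l - u n) <= c / (1 - r) * r ^+ n.
Proof.
move=> r0 r1 h.
have r1' : 0 < 1 - r by rewrite subr_gt0.
have c0 : 0 <= c by have := h 0%N; rewrite expr0 mulr1; apply: le_trans (nm_ge0 _).
set K := c / (1 - r).
have K0 : 0 <= K by rewrite divr_ge0 // ltW.
have cK : c = K * (1 - r) by rewrite /K divfK // gt_eqF.
have tail n m : nm (u (n + m)%N - u n) <= K * r ^+ n.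
  apply: (@le_trans _ _ (K * (r ^+ n - r ^+ (n + m)))); last first.
    by rewrite ler_wpM2l // lerBlDr lerDl exprn_ge0.
  elim: m => [|m IH]; first by rewrite addn0 !subrr nm0 mulr0.
  rewrite addnS.
  have -> : u (n + m).+1 - u n = (u (n + m).+1 - u (n + m)%N) + (u (n + m)%N - u n).
    by lmodule_eq R[i]; ring.
  apply: le_trans (nmD _ _) _.
  have := h (n + m)%N; rewrite cK exprS; nra.
have cu : cvg (u @ \oo).
  apply/cauchy_cvgP; apply: cauchy_exP => e e0.
  have [e' e'0 eE] : exists2 e' : R, 0 < e' & e = e'%:C.
    exists (complex.Re e); last by rewrite RRe_real // gtr0_real.
    by rewrite -ltcR RRe_real // gtr0_real.
  have [N hN] := geo_small K r0 r1 e'0.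
  exists (u N), N => // m /= leNm.
  rewrite -ball_normE /= nmE eE ltcR nm_distC -(subnKC leNm).
  exact: le_lt_trans (tail _ _) hN.
exists (lim (u @ \oo)) => n.
apply: (@le_eps _ _ 1) => e e0 _; rewrite mulr1.
have e0C : 0 < e%:C by rewrite ltcR.
have /cvgrPdist_lt /(_ _ e0C) [N _ hN] := cu.
have /= := hN (n + N)%N (leq_addl _ _); rewrite nmE ltcR => /ltW hl.
have -> : lim (u @ \oo) - u n = (u (n + N)%N - u n) + (lim (u @ \oo) - u (n + N)%N).
  by lmodule_eq R[i]; ring.
by apply: le_trans (nmD _ _) _; apply: lerD.
Qed.
End GeometricLimits.

(** * Symmetric maps *)

Section SymmetricOperators.
Variable R : realType.

(** The common part of a C*-algebra with [star a ** b] and of a Hilbert module;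
    positivity of the values is left out because for [star a ** a] it is one of
    the deeper facts about C*-algebras. *)
Record inner_form (V Z : normedModType R[i]) := InnerForm {
  iform :> V -> V -> Z;
  ipDr : forall x y z, iform x (y + z) = iform x y + iform x z;
  ipDl : forall x y z, iform (x + y) z = iform x z + iform y z;
  ipZr : forall (k : R[i]) x y, iform x (k *: y) = k *: iform x y;
  ipZl : forall (k : R[i]) x y, iform (k *: x) y = (k^* )%R *: iform x y;
  ip_norm : forall x, nm (iform x x) = nm x ^+ 2;
  ip_le : forall x y, nm (iform x y) <= nm x * nm y }.

Variables (Z : normedModType R[i]) (V : completeNormedModType R[i]).
Variable B : inner_form V Z.
Implicit Types (x y z : V) (s t c e : R).

Lemma conj_rc t : ((t%:C)^* )%R = t%:C.
Proof. exact: conjc_real. Qed.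

Lemma conj_i : (('i%C : R[i])^* )%R = - 'i%C.
Proof. by apply/eqP; rewrite eq_complex /= oppr0 !eqxx. Qed.

Lemma ipNr x y : B x (- y) = - B x y.
Proof. by rewrite -scaleN1r ipZr scaleN1r. Qed.

Lemma ipNl x y : B (- x) y = - B x y.
Proof. by rewrite -scaleN1r ipZl rmorphN1 scaleN1r. Qed.

Lemma ip_inj x y : (forall z, B x z = B y z) -> x = y.
Proof.
move=> h; apply/eqP; rewrite -subr_eq0; apply/eqP/nm_le0.
have : nm (B (x - y) (x - y)) = 0 by rewrite ipDl ipNl h subrr nm0.
by rewrite ip_norm => /eqP; rewrite sqrf_eq0 => /eqP ->.
Qed.

(** Linearity and boundedness are consequences of symmetry: [symD], [symZ],
    [sym_bounded]. *)
Record symop := Symop {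
  symf :> V -> V;
  symE : forall x y, B (symf x) y = B x (symf y) }.
Implicit Types f g h k : symop.

Lemma symD f : {morph f : x y / x + y}.
Proof. by move=> x y; apply: ip_inj => z; rewrite ipDl !symE ipDl. Qed.

Lemma symZ f (a : R[i]) x : f (a *: x) = a *: f x.
Proof. by apply: ip_inj => z; rewrite ipZl !symE ipZl. Qed.

Lemma symN f x : f (- x) = - f x.
Proof. by rewrite -scaleN1r symZ scaleN1r. Qed.

Lemma sym0 f : f 0 = 0.
Proof. by have := symZ f 0 0; rewrite !scale0r. Qed.

Definition sym_lin := (symD, symN, symZ, sym0).

Definition bnd (f : V -> V) c := forall x, nm (f x) <= c * nm x.

(** Hellinger-Toeplitz, by a gliding hump.  If f were unbounded, choose y_n with
    |f y_n| > 8^n |y_n| and add up vectors w_n of norm 4^-n parallel to f y_n,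
    keeping w_n only when the functional [B (f y_n)] would otherwise be small at
    the partial sum.  At the limit l these functionals still have size about
    4^-n |f y_n|, while symmetry bounds them by |y_n| |f l|. *)
Lemma sym_bounded f : exists2 c, 0 < c & bnd f c.
Proof.
apply: contrapT => nex.
have unb c : 0 < c -> ~ bnd f c by move=> c0 hc; apply: nex; exists c.
have /choice [y hy] n : exists y, 8 ^+ n * nm y < nm (f y).
  apply: contrapT => /forallNP h; apply: (unb (8 ^+ n)); first exact: exprn_gt0.
  by move=> x; rewrite leNgt; apply/negP/h.
have fy0 n : 0 < nm (f (y n)).
  by apply: le_lt_trans (hy n); rewrite mulr_ge0 ?nm_ge0 ?exprn_ge0.
pose w n := (4^-1 ^+ n / nm (f (y n)))%:C *: f (y n).
have nw n : nm (w n) = 4^-1 ^+ n.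
  by rewrite nmZ ger0_norm ?divr_ge0 ?nm_ge0 ?exprn_ge0 ?invr_ge0 // divfK // gt_eqF.
pose T n x := nm (B (f (y n)) x).
have Tw n : T n (w n) = 4^-1 ^+ n * nm (f (y n)).
  rewrite /T ipZr nmZ ip_norm ger0_norm ?divr_ge0 ?nm_ge0 ?exprn_ge0 ?invr_ge0 //.
  by rewrite expr2 mulrA divfK // gt_eqF.
have TD n a b : T n (a + b) <= T n a + T n b by rewrite /T ipDr nmD.
have TN n a : T n (- a) = T n a by rewrite /T ipNr nmN.
(* One of [u m] and [u m + w m] is at least half of [T m (w m)]. *)
pose fix u n := if n is m.+1 then
   (if 2^-1 * T m (w m) <= T m (u m) then u m else u m + w m) else 0 : V.
have uT n : 2^-1 * T n (w n) <= T n (u n.+1).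
  rewrite /=; case: ifP => // /negbT; rewrite -ltNge => lt.
  have := TD n (u n + w n) (- u n); rewrite TN.
  have -> : u n + w n - u n = w n by lmodule_eq R[i]; ring.
  lra.
have du n : nm (u n.+1 - u n) <= 1 * 4^-1 ^+ n.
  rewrite /= mul1r; case: ifP => _; first by rewrite subrr nm0 exprn_ge0 // invr_ge0.
  by rewrite addrAC subrr add0r nw.
have [||l hl] := geometric_cvg _ _ du; [by lra|by lra|].
have r0 : (0:R) <= 2^-1 by lra.
have r1 : 2^-1 < 1 :> R by lra.
suff : (1:R) <= 0 by rewrite ler10.
apply: (@geo_le0 _ _ (6 * nm (f l)) 2^-1) => // n.
have e4 : (4^-1 ^+ n : R) = 2^-1 ^+ n * 2^-1 ^+ n by rewrite -exprMn; congr (_ ^+ _); field.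
have e8 : (8 ^+ n : R) * (2^-1 ^+ n * 2^-1 ^+ n * 2^-1 ^+ n) = 1.
  by rewrite -!exprMn (_ : 8 * _ = 1) ?expr1n //; field.
have p0 : 0 < (2^-1 ^+ n : R) by apply: exprn_gt0; lra.
(* The tail of the series is at most 4^-n / 3, against the 4^-n / 2 gained. *)
have tail : T n (l - u n.+1) <= nm (f (y n)) * (3^-1 * 4^-1 ^+ n).
  apply: le_trans (ip_le _ _ _) _; rewrite ler_wpM2l ?nm_ge0 //.
  apply: le_trans (hl n.+1) _; rewrite exprS.
  have e3 : 1 / (1 - 4^-1) * 4^-1 = 3^-1 :> R by field.
  by rewrite mulrA e3.
have Tl : T n l <= nm (y n) * nm (f l) by rewrite /T symE ip_le.
have := uT n; have := TD n l (u n.+1 - l); rewrite -(TN n (u n.+1 - l)) opprB.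
have -> : l + (u n.+1 - l) = u n.+1 by lmodule_eq R[i]; ring.
rewrite Tw => h1 h2.
have h3 : 4^-1 ^+ n * nm (f (y n)) <= 6 * (nm (y n) * nm (f l)) by lra.
have y0 : 0 < nm (y n).
  rewrite lt_neqAle nm_ge0 andbT eq_sym; apply/eqP => y0.
  by have := fy0 n; rewrite (nm_le0 (x := y n)) ?y0 // sym0 nm0 ltxx.
have h4 : 4^-1 ^+ n * (8 ^+ n * nm (y n)) <= 6 * (nm (y n) * nm (f l)).
  apply: le_trans h3; rewrite ler_wpM2l ?exprn_ge0 ?invr_ge0 //; exact: ltW.
have h5 : 4^-1 ^+ n * 8 ^+ n <= 6 * nm (f l).
  by rewrite -(ler_pM2r y0) -mulrA; apply: le_trans h4 _; rewrite -mulrA (mulrC (nm (y n))).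
move: h5 e8; rewrite e4; set p := 2^-1 ^+ n; set q := 8 ^+ n => h5 e8.
rewrite -[leLHS]e8 [leRHS]mulrC (_ : q * _ = p * (p * p * q)).
  by rewrite ler_wpM2l // ltW.
by rewrite mulrC -!mulrA.
Qed.

End SymmetricOperators.

(** * Square roots *)

Section SquareRoots.
Variable R : realType.
Variables (Z : normedModType R[i]) (V : completeNormedModType R[i]).
Variable B : inner_form V Z.
Local Notation symop := (symop B).
Implicit Types (x y z : V) (a b c d e r s t : R) (f g h k : symop).

Lemma ipZr_real t x y : B x (t%:C *: y) = t%:C *: B x y.
Proof. by rewrite ipZr. Qed.

Lemma ipZl_real t x y : B (t%:C *: x) y = t%:C *: B x y.
Proof. by rewrite ipZl conj_rc. Qed.

Program Definition sone : symop := @Symop _ _ _ B id _.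
Next Obligation. by []. Qed.

Program Definition scomb a f b g : symop :=
  @Symop _ _ _ B (fun x => a%:C *: f x + b%:C *: g x) _.
Next Obligation.
by move=> a f b g x y /=; rewrite ipDl ipDr !ipZl_real !ipZr_real !symE.
Qed.

Program Definition scomp f g (fg : forall x, f (g x) = g (f x)) : symop :=
  @Symop _ _ _ B (f \o g) _.
Next Obligation. by move=> f g fg x y /=; rewrite !symE fg. Qed.

Definition ssq f : symop := @scomp f f (fun=> erefl).

Lemma bnd_comp (f g : V -> V) a b : 0 <= a -> bnd f a -> bnd g b ->
  bnd (f \o g) (a * b).
Proof.
move=> a0 hf hg x; apply: le_trans (hf _) _.
by rewrite -mulrA ler_wpM2l.
Qed.

Lemma bnd_comb f g s t a b : bnd f a -> bnd g b ->
  bnd (scomb s f t g) (`|s| * a + `|t| * b).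
Proof.
move=> hf hg x /=; apply: le_trans (nmD _ _) _; rewrite !nmZ mulrDl -!mulrA.
by apply: lerD; rewrite ler_wpM2l.
Qed.

Lemma bndW (f : V -> V) a b : a <= b -> bnd f a -> bnd f b.
Proof. by move=> ab hf x; apply: le_trans (hf x) _; rewrite ler_wpM2r ?nm_ge0. Qed.

Lemma geo_eq x y c r : 0 <= r -> r < 1 ->
  (forall n, nm (x - y) <= c * r ^+ n) -> x = y.
Proof.
move=> r0 r1 h; apply/eqP; rewrite -subr_eq0; apply/eqP/nm_le0.
exact: geo_le0 r0 r1 h.
Qed.

(** The root is 1 - Y where Y is the fixed point of y |-> (h + y^2) / 2, a
    contraction of ratio r on the maps bounded by r.  The iterates are
    polynomials in h, hence Y commutes with all that commutes with h. *)
Lemma sqrt_one_minus h r : 0 <= r -> r < 1 -> bnd h r ->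
  exists k, (forall x, k (k x) = x - h x) /\
   (forall g, (forall x, g (h x) = h (g x)) -> forall x, g (k x) = k (g x)).
Proof.
move=> r0 r1 hr.
have r1' : 0 < 1 - r by rewrite subr_gt0.
pose fix y n : symop :=
  if n is m.+1 then scomb 2^-1 h 2^-1 (ssq (y m)) else scomb 0 h 0 h.
have yS n x : y n.+1 x = 2^-1%:C *: h x + 2^-1%:C *: y n (y n x) by [].
have h2 : `|2^-1 : R| = 2^-1 by rewrite ger0_norm // invr_ge0.
have yr n : bnd (y n) r.
  elim: n => [|n IH].
    apply: bndW (bnd_comb 0 0 hr hr); rewrite normr0; lra.
  have := bnd_comb (g := ssq (y n)) 2^-1 2^-1 hr (bnd_comp r0 IH IH); apply: bndW.
  rewrite h2; nra.
have dy n : bnd (fun x => y n.+1 x - y n x) (r * r ^+ n).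
  elim: n => [|n IH] x.
    rewrite expr0 mulr1 /= rmorph0 !scale0r !addr0 subr0 scaler0 addr0.
    rewrite nmZ h2; have := hr x; have := nm_ge0 (h x); lra.
  have -> : y n.+2 x - y n.+1 x = 2^-1%:C *:
     (y n.+1 (y n.+1 x - y n x) + (y n.+1 (y n x) - y n (y n x))).
    by rewrite (yS n.+1) [in X in _ - X](yS n) !sym_lin; lmodule_eq R[i]; ring.
  rewrite nmZ h2; apply: (@le_trans _ _ (2^-1 * (r * (r * r ^+ n * nm x) +
     r * r ^+ n * (r * nm x)))).
    rewrite ler_wpM2l ?invr_ge0 //; apply: le_trans (nmD _ _) _; apply: lerD.
      by apply: le_trans (yr _ _) _; rewrite ler_wpM2l //; exact: IH.
    apply: le_trans (IH _) _; rewrite ler_wpM2l ?mulr_ge0 ?exprn_ge0 //.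
    exact: yr.
  rewrite exprS; set p := r ^+ n; set q := nm x; rewrite le_eqVlt.
  by apply/orP; left; apply/eqP; field.
pose K := r / (1 - r).
have K0 : 0 <= K by rewrite divr_ge0 // ltW.
have /choice [Y hY] : forall x, exists l, forall n,
    nm (l - y n x) <= K * nm x * r ^+ n.
  move=> x; have [n|l hl] := @geometric_cvg _ _ (y^~ x) (r * nm x) r r0 r1.
    by apply: le_trans (dy n x) _; rewrite mulrAC.
  by exists l => n; apply: le_trans (hl n) _; rewrite /K (mulrAC r).
have symY x z : B (Y x) z = B x (Y z).
  apply/eqP; rewrite -subr_eq0; apply/eqP/nm_le0.
  apply: (geo_le0 (c := K * nm x * nm z + nm x * (K * nm z)) r0 r1) => n.
  have -> : B (Y x) z - B x (Y z) = B (Y x - y n x) z - B x (Y z - y n z).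
    rewrite ipDl ipDr ipNl ipNr symE; lmodule_eq R[i]; ring.
  apply: le_trans (nmB _ _) _; rewrite mulrDl; apply: lerD.
    apply: le_trans (ip_le _ _ _) _; rewrite [leRHS]mulrAC.
    by rewrite ler_wpM2r ?nm_ge0.
  by apply: le_trans (ip_le _ _ _) _; rewrite -[leRHS]mulrA ler_wpM2l ?nm_ge0.
have Yfix x : 2%:C *: Y x = h x + Y (Y x).
  apply: (geo_eq (c := 2 * K * nm x * r + r * (K * nm x) + K * nm (Y x)) r0 r1) => n.
  have -> : 2%:C *: Y x - (h x + Y (Y x)) =
     2%:C *: (Y x - y n.+1 x) - (y n (Y x - y n x) + (Y (Y x) - y n (Y x))).
    by rewrite yS !sym_lin; lmodule_eq R[i]; field.
  apply: le_trans (nmB _ _) _; rewrite 2!mulrDl -addrA; apply: lerD.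
    rewrite nmZ ger0_norm // -[X in _ <= X * _]mulrA -[X in _ <= X * _]mulrA.
    by rewrite -[leRHS]mulrA ler_wpM2l // (mulrA K) -[leRHS]mulrA -exprS.
  apply: le_trans (nmD _ _) _; apply: lerD => //.
  by apply: le_trans (yr _ _) _; rewrite -[leRHS]mulrA ler_wpM2l.
pose Ys := Symop symY.
have YD x z : Y (x + z) = Y x + Y z := symD Ys x z.
have YZ (a : R[i]) x : Y (a *: x) = a *: Y x := symZ Ys a x.
exists (scomb 1 sone (-1) Ys); split=> [x|g hg x] /=.
  rewrite !(YD, YZ); have := Yfix x.
  move=> e; rewrite -[h x](addrK (Y (Y x))) -e; lmodule_eq R[i]; ring.
have gy n z : g (y n z) = y n (g z).
  elim: n z => [|n IH] z; first by rewrite /= !sym_lin hg.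
  by rewrite !yS !sym_lin hg !IH.
rewrite !sym_lin; congr (_ + _ *: _).
have [c c0 hc] := sym_bounded g.
apply: (geo_eq (c := c * (K * nm x) + K * nm (g x)) r0 r1) => n.
have -> : g (Y x) - Y (g x) = g (Y x - y n x) - (Y (g x) - y n (g x)).
  by rewrite !sym_lin gy; lmodule_eq R[i]; ring.
apply: le_trans (nmB _ _) _; rewrite mulrDl; apply: lerD => //.
by apply: le_trans (hc _) _; rewrite -[leRHS]mulrA ler_wpM2l // ltW.
Qed.

End SquareRoots.

(** * The cone of accretive maps *)

Section Accretive.
Variable R : realType.
Variables (Z : normedModType R[i]) (V : completeNormedModType R[i]).
Variable B : inner_form V Z.
Local Notation symop := (symop B).
Implicit Types (x y z : V) (a b c d e r s t K : R) (f g h k : symop).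

Lemma ipZr_i x y : B x ('i%C *: y) = 'i%C *: B x y.
Proof. by rewrite ipZr. Qed.

Lemma ipZl_i x y : B ('i%C *: x) y = - ('i%C *: B x y).
Proof. by rewrite ipZl conj_i scaleNr. Qed.

(** The C*-identity: |f x|^2 = |<x, f (f x)>|. *)
Lemma bnd_sqrt f c : 0 <= c -> bnd (ssq f) (c ^+ 2) -> bnd f c.
Proof.
move=> c0 h x; rewrite -ler_sqr ?nnegrE ?nm_ge0 ?mulr_ge0 ?nm_ge0 //.
rewrite -(ip_norm B) symE exprMn; apply: le_trans (ip_le _ _ _) _.
by rewrite mulrC [nm x ^+ 2]expr2 mulrA ler_wpM2r ?nm_ge0 //; exact: h.
Qed.

(** As f and g commute, the squared norms of (f + ig) x and (f - ig) x are both
    the norm of <x, (f^2 + g^2) x>, and f is the mean of f + ig and f - ig. *)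
Lemma sumsq_bound f g c : 0 <= c -> (forall x, f (g x) = g (f x)) ->
  bnd (fun x => f (f x) + g (g x)) (c ^+ 2) -> bnd f c.
Proof.
move=> c0 fg h.
have aux k x : (forall x, f (k x) = k (f x)) -> (forall x, k (k x) = g (g x)) ->
    nm (f x + 'i%C *: k x) <= c * nm x.
  move=> fk kk; rewrite -ler_sqr ?nnegrE ?nm_ge0 ?mulr_ge0 ?nm_ge0 //.
  rewrite -(ip_norm B) exprMn.
  have -> : B (f x + 'i%C *: k x) (f x + 'i%C *: k x) = B x (f (f x) + g (g x)).
    rewrite !(ipDr, ipDl, ipZr_i, ipZl_i) -kk.
    rewrite (symE f x (f x)) (symE k x (k x)) (symE f x (k x)) (symE k x (f x)) fk.
    by rewrite scalerBr scalerA -expr2 sqr_i; lmodule_eq R[i]; ring.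
  apply: le_trans (ip_le _ _ _) _.
  by rewrite mulrC [nm x ^+ 2]expr2 mulrA ler_wpM2r ?nm_ge0 //; exact: h.
move=> x.
have -> : f x = 2^-1%:C *: ((f x + 'i%C *: g x) + (f x + 'i%C *: scomb (-1) g 0 g x)).
  by rewrite /=; lmodule_eq R[i]; field.
rewrite nmZ ger0_norm ?invr_ge0 //.
have h1 := aux g x fg (fun=> erefl).
have h2 : nm (f x + 'i%C *: scomb (-1) g 0 g x) <= c * nm x.
  apply: aux => y /=; rewrite ?sym_lin ?fg //.
  by lmodule_eq R[i]; ring.
have := nmD (f x + 'i%C *: g x) (f x + 'i%C *: scomb (-1) g 0 g x); lra.
Qed.

(** The norm condition |s - f| <= s, read as f >= 0: in commutative terms the
    values of f lie in the disc of radius s around s, which meets the real line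
    in the interval from 0 to 2s. *)
Definition disc s (f : V -> V) := forall x, nm (s%:C *: x - f x) <= s * nm x.

Definition accretive (f : V -> V) := exists2 s, 0 <= s & disc s f.

Lemma disc_ext s (f g : V -> V) : f =1 g -> disc s f -> disc s g.
Proof. by move=> e h x; rewrite -e. Qed.

Lemma disc_le s t (f : V -> V) : s <= t -> disc s f -> disc t f.
Proof.
move=> st h x.
have -> : t%:C *: x - f x = (t - s)%:C *: x + (s%:C *: x - f x).
  by lmodule_eq R[i]; ring.
apply: le_trans (nmD _ _) _; rewrite nmZ ger0_norm ?subr_ge0 //.
have := h x; lra.
Qed.

(** The cone is closed provided that the radii of the approximants stay
    controlled, which is why [disc_bnd] matters. *)
Lemma disc_lim s K (f : V -> V) : 0 <= K ->
  (forall e, 0 < e -> e <= 1 -> exists2 g : V -> V, disc (s + e * K) g &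
     forall x, nm (f x - g x) <= e * K * nm x) -> disc s f.
Proof.
move=> K0 h x; apply: (@le_eps _ _ _ (3 * K * nm x)) => e e0 e1.
have [g hg fg] := h e e0 e1.
have -> : s%:C *: x - f x =
   ((s + e * K)%:C *: x - g x) - (f x - g x) - (e * K)%:C *: x.
  by lmodule_eq R[i]; ring.
apply: le_trans (nmB _ _) _; rewrite nmZ ger0_norm ?mulr_ge0 // ?(ltW e0) //.
have := nmB ((s + e * K)%:C *: x - g x) (f x - g x).
have := hg x; have := fg x; lra.
Qed.

(** For d > c the map f/d has a square of norm less than 1, so
    (f/d)^2 + k^2 = 1 for some k; then |k| <= 1 by [sumsq_bound], which bounds
    d^2 k^2 = d^2 - f^2. *)
Lemma disc_sq f c : 0 <= c -> bnd f c -> disc (c ^+ 2) (ssq f).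
Proof.
move=> c0 hf; have K0 : 0 <= 2 * c + 1 by lra.
apply: (disc_lim K0).
move=> e e0 e1; exists (ssq f); last first.
  by move=> x; rewrite subrr nm0 !mulr_ge0 ?nm_ge0 // (ltW e0).
apply: (@disc_le ((c + e) ^+ 2)); first by nra.
set d := c + e; have d0 : 0 < d by rewrite /d; lra.
pose h := scomb (d ^- 2) (ssq f) 0 f.
have hE x : h x = (d ^- 2)%:C *: f (f x) by rewrite /= rmorph0 scale0r addr0.
have r0 : 0 <= (c / d) ^+ 2 by rewrite exprn_ge0 // divr_ge0 // ltW.
have r1 : (c / d) ^+ 2 < 1.
  by rewrite expr_lt1 ?divr_ge0 ?(ltW d0) // ltr_pdivrMr // mul1r /d; lra.
have hr : bnd h ((c / d) ^+ 2).
  move=> x; rewrite hE nmZ ger0_norm ?invr_ge0 ?exprn_ge0 ?(ltW d0) //.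
  rewrite expr_div_n mulrAC [leRHS]mulrC ler_wpM2l ?invr_ge0 ?exprn_ge0 ?(ltW d0) //.
  exact: (bnd_comp c0 hf hf).
have [k [kk kc]] := sqrt_one_minus r0 r1 hr.
have fk x : f (k x) = k (f x) by apply: kc => {}x; rewrite !hE symZ.
pose f' := scomb d^-1 f 0 f.
have f'E x : f' x = d^-1%:C *: f x by rewrite /= rmorph0 scale0r addr0.
have k1 : bnd k 1.
  apply: (@sumsq_bound k f') => [//|x|x]; first by rewrite !f'E symZ fk.
  rewrite kk hE !f'E symZ expr1n mul1r.
  rewrite (_ : _ + _ = x) //.
  by lmodule_eq R[i]; field; rewrite fmorph_eq0 gt_eqF.
move=> x; rewrite (_ : _ - _ = (d ^+ 2)%:C *: k (k x)).
  rewrite nmZ ger0_norm ?exprn_ge0 ?(ltW d0) // ler_wpM2l ?exprn_ge0 ?(ltW d0) //.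
  by apply: le_trans (k1 _) _; rewrite mul1r; apply: le_trans (k1 _) _; rewrite mul1r.
by rewrite kk hE /=; lmodule_eq R[i]; field; rewrite fmorph_eq0 gt_eqF.
Qed.

(** f + e = (s + e) (1 - h) with |h| <= s / (s + e) < 1. *)
Lemma sqrt_shift f s e : 0 <= s -> disc s f -> 0 < e ->
  exists k, (forall x, k (k x) = f x + e%:C *: x) /\
   (forall g, (forall x, g (f x) = f (g x)) -> forall x, g (k x) = k (g x)).
Proof.
move=> s0 hf e0; set d := s + e; have d0 : 0 < d by rewrite /d; lra.
pose h := scomb (s / d) (sone B) (- d^-1) f.
have hE x : h x = (d^-1)%:C *: (s%:C *: x - f x).
  by rewrite /=; lmodule_eq R[i]; field; rewrite fmorph_eq0 gt_eqF.
have r0 : 0 <= s / d by rewrite divr_ge0 // ltW.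
have r1 : s / d < 1 by rewrite ltr_pdivrMr // mul1r /d; lra.
have hr : bnd h (s / d).
  move=> x; rewrite hE nmZ ger0_norm ?invr_ge0 ?(ltW d0) //.
  by rewrite [s / d]mulrC -mulrA ler_wpM2l // invr_ge0 ltW.
have [k [kk kc]] := sqrt_one_minus r0 r1 hr.
have dd : (Num.sqrt d)%:C * (Num.sqrt d)%:C = d%:C.
  by rewrite -rmorphM -expr2 sqr_sqrtr // ltW.
exists (scomb (Num.sqrt d) k 0 k); split=> [x|g hg x] /=.
  rewrite !sym_lin rmorph0 !scale0r !addr0 scalerA dd kk hE /d.
  lmodule_eq R[i]; field; rewrite -?rmorphD /= ?fmorph_eq0 gt_eqF //.
rewrite !sym_lin rmorph0 !scale0r !addr0 kc // => {}x.
by rewrite !hE !sym_lin hg.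
Qed.

(** The radius of an accretive map can be taken equal to any bound of its norm,
    since f + e is a square. *)
Lemma disc_bnd f s c : 0 <= s -> disc s f -> 0 <= c -> bnd f c -> disc c f.
Proof.
move=> s0 hs c0 hc; apply: (@disc_lim _ 1) => // e e0 e1; rewrite mulr1.
exists (fun x => f x + e%:C *: x); last first.
  move=> x; rewrite opprD addrA subrr add0r nmN nmZ ger0_norm //; exact: ltW.
have [k [kk _]] := sqrt_shift s0 hs e0.
have ce0 : 0 <= c + e by lra.
apply: (disc_ext kk); rewrite -(sqr_sqrtr ce0); apply: disc_sq.
  exact: sqrtr_ge0.
apply: bnd_sqrt; rewrite ?sqrtr_ge0 // sqr_sqrtr // => x.
rewrite /= kk mulrDl; apply: le_trans (nmD _ _) _; apply: lerD; first exact: hc.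
by rewrite nmZ ger0_norm // ltW.
Qed.

(** If 0 <= f <= c, both f + e and c - f + e are squares of commuting maps, and
    their sum is the scalar c + 2e. *)
Lemma bnd_le_disc f s t c : 0 <= s -> disc s f ->
  0 <= t -> disc t (fun x => c%:C *: x - f x) -> 0 <= c -> bnd f c.
Proof.
move=> s0 hs t0 ht c0 x; apply: (@le_eps _ _ _ (3 * nm x)) => e e0 e1.
pose g := scomb c (sone B) (-1) f.
have gE y : g y = c%:C *: y - f y by rewrite /= rmorphN1 scaleN1r.
have hg : disc t g by apply: disc_ext ht => y; rewrite gE.
have [k [kk kc]] := sqrt_shift s0 hs e0.
have [l [ll lc]] := sqrt_shift t0 hg e0.
have fk y : f (k y) = k (f y) by exact: kc.
have kl y : k (l y) = l (k y).
  by apply: lc => {}y; rewrite !gE !sym_lin fk.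
have ce0 : 0 <= c + 2 * e by lra.
have kb : bnd k (Num.sqrt (c + 2 * e)).
  apply: (sumsq_bound _ kl); rewrite ?sqrtr_ge0 // sqr_sqrtr // => y.
  rewrite kk ll gE.
  have -> : f y + e%:C *: y + (c%:C *: y - f y + e%:C *: y) = (c + 2 * e)%:C *: y.
    by lmodule_eq R[i]; ring.
  by rewrite nmZ ger0_norm.
have -> : f x = k (k x) - e%:C *: x by rewrite kk addrK.
apply: le_trans (nmB _ _) _; rewrite nmZ (ger0_norm (ltW e0)).
have := bnd_comp (sqrtr_ge0 _) kb kb x; rewrite -expr2 sqr_sqrtr //=; lra.
Qed.

Lemma disc_add (f g : V -> V) s t : disc s f -> disc t g ->
  disc (s + t) (fun x => f x + g x).
Proof.
move=> hf hg x.
have -> : (s + t)%:C *: x - (f x + g x) = (s%:C *: x - f x) + (t%:C *: x - g x).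
  by lmodule_eq R[i]; ring.
by rewrite mulrDl; apply: le_trans (nmD _ _) _; apply: lerD.
Qed.

Lemma accretive_ext (f g : V -> V) : f =1 g -> accretive f -> accretive g.
Proof. by move=> e [s s0 h]; exists s => //; apply: disc_ext h. Qed.

Lemma accretive_add (f g : V -> V) : accretive f -> accretive g ->
  accretive (fun x => f x + g x).
Proof.
move=> [s s0 hf] [t t0 hg]; exists (s + t); first exact: addr_ge0.
exact: disc_add.
Qed.

Lemma accretive_scale t (f : V -> V) : 0 <= t -> accretive f ->
  accretive (fun x => t%:C *: f x).
Proof.
move=> t0 [s s0 hf]; exists (t * s); first exact: mulr_ge0.
move=> x; have -> : (t * s)%:C *: x - t%:C *: f x = t%:C *: (s%:C *: x - f x).
  by lmodule_eq R[i]; ring.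
by rewrite nmZ ger0_norm // -mulrA ler_wpM2l.
Qed.

Lemma accretive_id t : 0 <= t -> accretive (fun x => t%:C *: x).
Proof.
move=> t0; exists t => // x; rewrite subrr nm0 mulr_ge0 ?nm_ge0 //.
Qed.

(** (f + e) (g + e) is the square of the product of the two roots, and its norm
    is bounded uniformly for e <= 1. *)
Lemma accretive_comp f g : (forall x, f (g x) = g (f x)) ->
  accretive f -> accretive g -> accretive (f \o g).
Proof.
move=> fg [s s0 hf] [t t0 hg].
have [a a0 ha] := sym_bounded f; have [b b0 hb] := sym_bounded g.
pose c := (a + 1) * (b + 1).
have c0 : 0 <= c by rewrite /c mulr_ge0 //; lra.
have K0 : 0 <= a + b + 1 by lra.
exists c => //; apply: (disc_lim K0) => e e0 e1.
have [k [kk kc]] := sqrt_shift s0 hf e0.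
have [l [ll lc]] := sqrt_shift t0 hg e0.
have gk y : g (k y) = k (g y) by apply: kc.
have kl y : k (l y) = l (k y) by apply: lc => {}y; rewrite gk.
exists (ssq (scomp kl)); last first.
  move=> x /=; rewrite -(kl (l x)) kk ll.
  have -> : f (g x) - (f (g x + e%:C *: x) + e%:C *: (g x + e%:C *: x)) =
    - (e%:C *: (f x + g x + e%:C *: x)) by rewrite !sym_lin; lmodule_eq R[i]; ring.
  rewrite nmN nmZ (ger0_norm (ltW e0)) -mulrA ler_wpM2l ?(ltW e0) //.
  apply: le_trans (nmD _ _) _; rewrite nmZ (ger0_norm (ltW e0)) !mulrDl.
  apply: lerD; last by rewrite ler_wpM2r ?nm_ge0.
  by apply: le_trans (nmD _ _) _; apply: lerD.
apply: (@disc_le c); first by rewrite lerDl mulr_ge0 // ltW.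
rewrite -(sqr_sqrtr c0); apply: disc_sq; first exact: sqrtr_ge0.
apply: bnd_sqrt; rewrite ?sqrtr_ge0 // sqr_sqrtr // => x /=.
rewrite -(kl (l x)) kk ll /c.
have u : nm (g x + e%:C *: x) <= (b + 1) * nm x.
  apply: le_trans (nmD _ _) _; rewrite nmZ (ger0_norm (ltW e0)) mulrDl.
  by apply: lerD; rewrite ?hb // ler_wpM2r ?nm_ge0.
apply: le_trans (nmD _ _) _; rewrite nmZ (ger0_norm (ltW e0)).
apply: (@le_trans _ _ ((a + 1) * nm (g x + e%:C *: x))).
  by rewrite mulrDl; apply: lerD; rewrite ?ha // ler_wpM2r ?nm_ge0.
by rewrite -mulrA ler_wpM2l //; lra.
Qed.

(** c^2 - g^2 is the product of c - g and c + g, so 0 <= g^2 <= c^2. *)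
Lemma bnd_interval g c : 0 <= c ->
  accretive (fun x => c%:C *: x - g x) -> accretive (fun x => c%:C *: x + g x) ->
  bnd g c.
Proof.
move=> c0 hm hp.
pose m := scomb c (sone B) (-1) g; pose p := scomb c (sone B) 1 g.
have mE x : m x = c%:C *: x - g x by rewrite /= rmorphN1 scaleN1r.
have pE x : p x = c%:C *: x + g x by rewrite /= scale1r.
have mp x : m (p x) = p (m x).
  by rewrite !mE !pE !sym_lin; lmodule_eq R[i]; ring.
have [] := accretive_comp mp.
- by apply: accretive_ext hm => x; rewrite mE.
- by apply: accretive_ext hp => x; rewrite pE.
move=> t t0 ht.
have [a a0 ha] := sym_bounded g.
apply: bnd_sqrt => //.
have a20 : 0 <= a ^+ 2 by rewrite exprn_ge0 // ltW.
apply: (bnd_le_disc a20 (disc_sq (ltW a0) ha) t0 _ (exprn_ge0 2 c0)).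
apply: disc_ext ht => x /=; rewrite !sym_lin.
by lmodule_eq R[i]; ring.
Qed.

Lemma bnd_shift f s : bnd f s -> disc s (fun x => s%:C *: x - f x).
Proof. by move=> h x; rewrite opprB addrC subrK. Qed.

Lemma sym_inverse f (S : V -> V) : (forall x, f (S x) = x) ->
  forall x y, B (S x) y = B x (S y).
Proof. by move=> fS x y; rewrite -{1}(fS y) -symE fS. Qed.

(** The inverse S = S^2 f is accretive, and so is (M - S) f = M f - 1 for
    M >= |S|; hence f >= 1/M. *)
Lemma accretive_inverse_gap f (S : V -> V) : accretive f ->
  (forall x, f (S x) = x) -> (forall x, S (f x) = x) ->
  exists2 d, 0 < d & accretive (fun x => f x - d%:C *: x).
Proof.
move=> hf fS Sf; pose T := Symop (sym_inverse fS).
have [M M0 hM] := sym_bounded T.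
have hT : accretive T.
  have TTf x : ssq T (f x) = f (ssq T x) by rewrite /= Sf fS.
  apply: (accretive_ext (f := ssq T \o f)) => [x|]; first by rewrite /= Sf.
  apply: accretive_comp => //; exists (M ^+ 2); first by rewrite exprn_ge0 // ltW.
  exact: disc_sq (ltW M0) hM.
pose N := scomb M (sone B) (-1) T.
have NE x : N x = M%:C *: x - T x by rewrite /= rmorphN1 scaleN1r.
have Nf x : N (f x) = f (N x) by rewrite !NE /= !sym_lin Sf fS.
have hN : accretive N.
  exists M; first exact: ltW.
  by apply: disc_ext (bnd_shift hM) => x; rewrite NE.
exists M^-1; first by rewrite invr_gt0.
have := accretive_scale (ltW (_ : 0 < M^-1)) (accretive_comp Nf hN hf).
rewrite invr_gt0 => /(_ M0); apply: accretive_ext => x.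
rewrite [(_ \o _) x]NE /= Sf.
by lmodule_eq R[i]; field; rewrite fmorph_eq0 gt_eqF.
Qed.

(** Let m be the least l >= 0 for which f + l is accretive; it exists by
    closedness.  If m > 0, then f + m is invertible and [accretive_inverse_gap]
    contradicts the minimality of m. *)
Lemma accretive_of_shifts f :
  (forall l, 0 < l -> exists S : V -> V,
     (forall x, f (S x) + l%:C *: S x = x) /\ (forall x, S (f x + l%:C *: x) = x)) ->
  accretive f.
Proof.
move=> inv.
pose E := [set l | 0 <= l /\ accretive (fun x => f x + l%:C *: x)].
have [c c0 hc] := sym_bounded f.
pose sh l := scomb 1 f l (sone B).
have shE l x : sh l x = f x + l%:C *: x by rewrite /= scale1r.
have Ec : E c.
  split; first exact: ltW.
  exists c; first exact: ltW.
  move=> x; rewrite opprD addrCA subrr addr0 nmN; exact: hc.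
have lbE : lbound E 0 by move=> l [].
have iE : has_inf E by split; [exists c | exists 0].
have l0 : 0 <= inf E by apply: lb_le_inf => //; exists c.
have Eup l l' : l <= l' -> E l -> E l'.
  move=> ll' [p hl]; split; first exact: le_trans ll'.
  have d0 : 0 <= l' - l by rewrite subr_ge0.
  apply: accretive_ext (accretive_add hl (accretive_id d0)) => x.
  by lmodule_eq R[i]; ring.
have Einf : E (inf E).
  split => //; have s0 : 0 <= c + inf E by apply: addr_ge0 => //; exact: ltW.
  exists (c + inf E) => //; apply: (@disc_lim _ 1) => // e e0 e1; rewrite mulr1.
  have [l [p [s s0' hl]] le] := inf_adherent e0 iE.
  have gl : inf E <= l by apply: ge_inf; [exists 0 | split; [|exists s]].
  have {}hl : disc s (sh l) by apply: disc_ext hl => x; rewrite shE.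
  have cl0 : 0 <= c + l by apply: addr_ge0 => //; exact: ltW.
  exists (sh l).
    apply: (@disc_le (c + l)); first by lra.
    apply: (disc_bnd s0' hl) => // x; rewrite shE mulrDl.
    by apply: le_trans (nmD _ _) _; apply: lerD; rewrite ?hc // nmZ ger0_norm.
  move=> x; rewrite shE; have -> : f x + (inf E)%:C *: x - (f x + l%:C *: x) =
    (inf E - l)%:C *: x by lmodule_eq R[i]; ring.
  by rewrite nmZ ler_wpM2r ?nm_ge0 // ler0_norm; lra.
suff z : inf E = 0.
  by move: Einf; rewrite z => -[_]; apply: accretive_ext => x; rewrite rmorph0 scale0r addr0.
apply/eqP; rewrite eq_le l0 andbT leNgt; apply/negP => lpos.
have [S [S1 S2]] := inv _ lpos.
have [|||d d0 hd] := @accretive_inverse_gap (sh (inf E)) S.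
- by move: Einf => [_]; apply: accretive_ext => x; rewrite shE.
- by move=> x; rewrite shE.
- by move=> x; rewrite shE.
have [dl|dl] := leP d (inf E).
  have : E (inf E - d).
    split; first by rewrite subr_ge0.
    by apply: accretive_ext hd => x; rewrite shE; lmodule_eq R[i]; ring.
  by move=> /(ge_inf (ex_intro _ _ lbE)); lra.
have : E 0.
  split => //; have d0' : 0 <= d - inf E by rewrite subr_ge0 ltW.
  apply: accretive_ext (accretive_add hd (accretive_id d0')) => x.
  by rewrite shE; lmodule_eq R[i]; ring.
by move=> /(ge_inf (ex_intro _ _ lbE)); lra.
Qed.

Lemma one_minus_solve h r : 0 <= r -> r < 1 -> bnd h r ->
  forall y, exists z, z - h z = y.
Proof.
move=> r0 r1 hr y.
pose fix u n := if n is m.+1 then y + h (u m) else 0 : V.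
have uS n : u n.+1 = y + h (u n) by [].
have du n : nm (u n.+1 - u n) <= nm y * r ^+ n.
  elim: n => [|n IH]; first by rewrite /= sym0 addr0 subr0 expr0 mulr1.
  have -> : u n.+2 - u n.+1 = h (u n.+1 - u n).
    by rewrite symD symN (uS n.+1) [in X in _ - X = _](uS n); lmodule_eq R[i]; ring.
  by apply: le_trans (hr _) _; rewrite exprS mulrCA ler_wpM2l.
have [z hz] := geometric_cvg r0 r1 du.
exists z; apply: (geo_eq (c := nm y / (1 - r) * r + r * (nm y / (1 - r))) r0 r1) => n.
have -> : z - h z - y = (z - u n.+1) - h (z - u n).
  by rewrite symD symN uS; lmodule_eq R[i]; ring.
apply: le_trans (nmB _ _) _; rewrite mulrDl; apply: lerD.
  by rewrite -mulrA -exprS; exact: hz.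
by apply: le_trans (hr _) _; rewrite -mulrA ler_wpM2l.
Qed.

(** f + l = d (1 - h) with d = s + l and |h| <= s / d < 1, and 1 - h is inverted
    by a Neumann series. *)
Lemma accretive_shift_inverse f l : accretive f -> 0 < l ->
  exists S : symop,
    (forall x, f (S x) + l%:C *: S x = x) /\ (forall x, S (f x + l%:C *: x) = x).
Proof.
move=> [s s0 hs] l0; pose d := s + l; have d0 : 0 < d by rewrite /d; lra.
pose h := scomb (s / d) (sone B) (- d^-1) f.
have hE x : d%:C *: (x - h x) = f x + l%:C *: x.
  by rewrite /= /d; lmodule_eq R[i]; field; rewrite -rmorphD fmorph_eq0 gt_eqF.
have r0 : 0 <= s / d by rewrite divr_ge0 // ltW.
have r1 : s / d < 1 by rewrite ltr_pdivrMr // mul1r /d; lra.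
have hr : bnd h (s / d).
  move=> x; have -> : h x = d^-1%:C *: (s%:C *: x - f x).
    by rewrite /=; lmodule_eq R[i]; field; rewrite fmorph_eq0 gt_eqF.
  rewrite nmZ ger0_norm ?invr_ge0 ?(ltW d0) //.
  by rewrite [s / d]mulrC -mulrA ler_wpM2l // invr_ge0 ltW.
have ex y : exists z, f z + l%:C *: z = y.
  have [z hz] := one_minus_solve r0 r1 hr (d^-1%:C *: y).
  exists z; rewrite -hE hz scalerA -rmorphM divff ?gt_eqF //.
  by rewrite rmorph1 scale1r.
have /choice [S hS] := ex.
pose g := scomb 1 f l (sone B).
have gE x : g x = f x + l%:C *: x by rewrite /= scale1r.
have gS x : g (S x) = x by rewrite gE hS.
exists (Symop (sym_inverse gS)); split=> x //=.
apply/eqP; rewrite -subr_eq0; apply/eqP/nm_le0.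
set w := _ - _.
have w0 : w - h w = 0.
  apply: (scalerI (_ : d%:C != 0)); first by rewrite fmorph_eq0 gt_eqF.
  by rewrite scaler0 hE -gE /w !sym_lin gS gE subrr.
have := hr w; move/eqP: w0; rewrite subr_eq0 => /eqP <-.
have := nm_ge0 w; nra.
Qed.

End Accretive.

(** * The positive cone of a C*-algebra *)

Section AlgebraCone.
Variables (R : realType) (Alg : cstarAlgType R).
Implicit Types (a b g p : Alg) (c e s t l : R).

Lemma nm_smul a b : nm (a ** b) <= nm a * nm b.
Proof. by rewrite -lecR rmorphM /= -!nmE; exact: cstar_normM. Qed.

Lemma nm_star_smul a : nm (star a ** a) = nm a ^+ 2.
Proof. by apply: (@complexI R); rewrite rmorphXn /= -!nmE cstar_normE. Qed.

Lemma nm_star a : nm (star a) = nm a.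
Proof.
have le b : nm b <= nm (star b).
  have [b0|b0] := leP (nm b) 0; first exact: le_trans b0 (nm_ge0 _).
  by rewrite -(ler_pM2r b0) -expr2 -nm_star_smul nm_smul.
by apply/eqP; rewrite eq_le le andbT; have := le (star a); rewrite starK.
Qed.

Lemma smulNl a b : (- a) ** b = - (a ** b).
Proof. by rewrite -scaleN1r smulZl scaleN1r. Qed.

Lemma smulNr a b : a ** (- b) = - (a ** b).
Proof. by rewrite -scaleN1r smulZr scaleN1r. Qed.

Lemma starN (A : starAlgType R) (a : A) : star (- a) = - star a.
Proof. by rewrite -scaleN1r starZ rmorphN1 scaleN1r. Qed.

Lemma starZ_real t a : star (t%:C *: a) = t%:C *: star a.
Proof. by rewrite starZ conj_rc. Qed.

Program Definition alg_form : inner_form Alg Alg :=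
  @InnerForm R Alg Alg (fun a b => star a ** b) _ _ _ _ _ _.
Next Obligation. by move=> a b c /=; rewrite smulDr. Qed.
Next Obligation. by move=> a b c /=; rewrite starD smulDl. Qed.
Next Obligation. by move=> k a b /=; rewrite smulZr. Qed.
Next Obligation. by move=> k a b /=; rewrite starZ smulZl. Qed.
Next Obligation. by move=> a /=; rewrite nm_star_smul. Qed.
Next Obligation. by move=> a b /=; rewrite -(nm_star a) nm_smul. Qed.

Lemma mulop_sym a (ha : star a = a) b g : alg_form (a ** b) g = alg_form b (a ** g).
Proof. by rewrite /= starM ha smulA. Qed.

Definition mulop a (ha : star a = a) : symop alg_form := Symop (mulop_sym ha).

Lemma mulop_bnd a : bnd (smul a) (nm a).
Proof. by move=> b; exact: nm_smul. Qed.

(** The order of the algebra expressed by its action on itself by left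
    multiplication, which replaces the unitization. *)
Definition pos a := star a = a /\ accretive (smul a).

(** If b is a quasi-inverse of - a / l, then (1 - b) / l inverts a + l. *)
Lemma positive_pos a : positive a -> pos a.
Proof.
move=> [ha sp]; split=> //; apply: (accretive_of_shifts (f := mulop ha)) => l l0.
have [b [b1 b2]] : quasi_invertible ((- l%:C)^-1 *: a).
  apply: contrapT => nq; have /sp : spectrum a (- l%:C) by right.
  by rewrite oppr_ge0 -(rmorph0 (real_complex R)) lecR leNgt l0.
have l0' : l%:C != 0 by rewrite fmorph_eq0 gt_eqF.
exists (fun x => (l^-1)%:C *: (x - b ** x)); split=> x /=.
  have := congr1 (fun u => u ** x) b1.
  rewrite !smulDl smulNl -smulA !smulZl -(scale0r 0) smulZl scale0r => e1.
  rewrite !(smulDr, smulNr, smulZr).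
  transitivity (x - ((- l%:C)^-1 *: (a ** x) + b ** x - (- l%:C)^-1 *: (a ** (b ** x)))).
    by lmodule_eq R[i]; field.
  by rewrite e1 subr0.
have := congr1 (fun u => u ** x) b2.
rewrite !smulDl smulNl -smulA !smulZl smulZr -(scale0r 0) smulZl scale0r => e1.
rewrite !(smulDr, smulNr, smulZr).
transitivity (x - ((- l%:C)^-1 *: (a ** x) + b ** x - (- l%:C)^-1 *: (b ** (a ** x)))).
  by lmodule_eq R[i]; field.
by rewrite e1 subr0.
Qed.

Lemma pos_add a b : pos a -> pos b -> pos (a + b).
Proof.
move=> [ha pa] [hb pb]; split; first by rewrite starD ha hb.
by apply: accretive_ext (accretive_add pa pb) => x; rewrite smulDl.
Qed.

Lemma pos_scale t a : 0 <= t -> pos a -> pos (t%:C *: a).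
Proof.
move=> t0 [ha pa]; split; first by rewrite starZ_real ha.
by apply: accretive_ext (accretive_scale t0 pa) => x; rewrite smulZl.
Qed.

Lemma pos_lim K a : 0 <= K -> star a = a ->
  (forall e, 0 < e -> e <= 1 -> exists2 b, pos b & nm (a - b) <= e * K) -> pos a.
Proof.
move=> K0 ha h; split=> //; exists (nm a); first exact: nm_ge0.
apply: (disc_lim K0) => e e0 e1; have [b [hb [s s0 hs]] ab] := h e e0 e1.
exists (smul b).
  apply: (@disc_le _ _ (nm b)).
    rewrite -(subKr a b); apply: le_trans (nmB _ _) _; exact: lerD.
  by apply: (disc_bnd (f := mulop hb) s0 hs (nm_ge0 _)); exact: mulop_bnd.
move=> x; rewrite -smulNl -smulDl; apply: le_trans (nm_smul _ _) _.
by rewrite ler_wpM2r ?nm_ge0.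
Qed.

(** Since r <= |r|, the hypotheses give -|r| <= g <= |r|. *)
Lemma pos_interval r g : star g = g -> pos (r - g) -> pos (r + g) -> nm g <= nm r.
Proof.
move=> hg [hm pm] [hp pp].
have hr : star r = r.
  have -> : r = 2^-1%:C *: ((r - g) + (r + g)) by lmodule_eq R[i]; field.
  by rewrite starZ_real starD hm hp.
have pr : accretive (fun x => (nm r)%:C *: x - r ** x).
  exists (nm r); first exact: nm_ge0.
  apply: (bnd_shift (f := mulop hr)); exact: mulop_bnd.
have gb : bnd (smul g) (nm r).
  apply: (bnd_interval (g := mulop hg)); first exact: nm_ge0.
    apply: accretive_ext (accretive_add pr pm) => x /=.
    by rewrite smulDl smulNl; lmodule_eq R[i]; ring.
  apply: accretive_ext (accretive_add pr pp) => x /=.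
  by rewrite smulDl; lmodule_eq R[i]; ring.
have [g0|g0] := leP (nm g) 0; first exact: le_trans g0 (nm_ge0 _).
by rewrite -(ler_pM2r g0) -expr2 -nm_star_smul hg; exact: gb.
Qed.

Lemma pos_norm a b : pos a -> pos (b - a) -> nm a <= nm b.
Proof.
move=> pa pba; apply: pos_interval => //; first by case: pa.
have -> : b + a = (b - a) + (a + a) by lmodule_eq R[i]; ring.
by apply: pos_add => //; apply: pos_add.
Qed.

End AlgebraCone.

(** * The Cauchy-Schwarz inequality in Hilbert modules *)

Section HilbertForm.
Variables (R : realType) (Alg : cstarAlgType R) (H : hilbertModType Alg).
Implicit Types (x y z : H) (a b : Alg).

Lemma nm_inner x : nm (inner x x) = nm x ^+ 2.
Proof. by apply: (@complexI R); rewrite rmorphXn /= -!nmE hilbert_normE. Qed.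

Lemma innerAl x y a : inner (ract x a) y = star a ** inner x y.
Proof. by rewrite innerC innerAr starM -innerC. Qed.

Lemma inner_pos x : pos (inner x x).
Proof. exact/positive_pos/inner_ge0. Qed.

(** With b = <y,x> and p = b* b, positivity of the form at x - s y b for s and
    for - s traps 2s p between plus and minus <x,x> + s^2 b* <y,y> b, and
    [pos_interval] bounds 2s |b|^2 = |2s p|.  The use of both signs of s replaces
    the positivity of b* b. *)
Lemma inner_norm_le x y : nm (inner x y) <= nm x * nm y.
Proof.
set n := nm _; have n0 : 0 <= n := nm_ge0 _.
pose b := inner y x; have nb : nm b = n by rewrite /b innerC nm_star.
pose p := star b ** b; pose N := star b ** (inner y y ** b).
have [Y0|Y0] := leP (nm y) 0.
  by rewrite /n (nm_le0 Y0) inner0r !nm0 mulr0.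
have hp : star p = p by rewrite /p starM starK.
have q (s : R) : pos (inner x x - (2 * s)%:C *: p + (s ^+ 2)%:C *: N).
  have := inner_pos (x - ract y (s%:C *: b)); congr pos.
  rewrite -scaleN1r !(innerDl, innerDr, innerZl, innerZr, rmorphN1) !innerAl !innerAr.
  rewrite /p /N -/b (innerC y x) -/b !(starZ_real, smulZl, smulZr) -?smulA.
  by lmodule_eq R[i]; ring.
(* With s = |y|^-2 the quadratic term becomes s |b|^2, half of the left side. *)
pose s := (nm y) ^- 2; have s0 : 0 <= s by rewrite invr_ge0 exprn_ge0 // nm_ge0.
have h : nm ((2 * s)%:C *: p) <= nm (inner x x + (s ^+ 2)%:C *: N).
  apply: pos_interval.
  - by rewrite starZ_real hp.
  - have := q s; congr pos; lmodule_eq R[i]; ring.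
  - have := q (- s); congr pos; lmodule_eq R[i]; ring.
have hN : nm N <= n * (nm y ^+ 2 * n).
  apply: le_trans (nm_smul _ _) _; rewrite nm_star nb ler_wpM2l //.
  by apply: le_trans (nm_smul _ _) _; rewrite nm_inner nb.
have np : nm p = n ^+ 2 by rewrite nm_star_smul nb.
have {}h : 2 * s * n ^+ 2 <= nm x ^+ 2 + s ^+ 2 * (n * (nm y ^+ 2 * n)).
  have := le_trans h (nmD _ _); rewrite !nmZ np nm_inner !ger0_norm ?exprn_ge0 //; last first.
    by rewrite mulr_ge0.
  move/le_trans; apply; rewrite lerD2l ler_wpM2l ?exprn_ge0 //.
rewrite -ler_sqr ?nnegrE ?mulr_ge0 ?nm_ge0 // exprMn.
have sY : s * nm y ^+ 2 = 1 by rewrite mulVf // expf_neq0 // gt_eqF.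
have e1 : s ^+ 2 * (n * (nm y ^+ 2 * n)) = s * n ^+ 2.
  by rewrite -[RHS]mul1r -sY; ring.
have {}h : s * n ^+ 2 <= nm x ^+ 2 by move: h; rewrite e1; lra.
have -> : n ^+ 2 = (s * n ^+ 2) * nm y ^+ 2 by rewrite mulrAC sY mul1r.
by rewrite ler_wpM2r ?exprn_ge0 ?nm_ge0.
Qed.

Program Definition hilbert_form : inner_form H Alg :=
  @InnerForm R H Alg (fun x y => inner x y) _ _ _ _ _ _.
Next Obligation. by move=> x y z /=; rewrite innerDr. Qed.
Next Obligation. by move=> x y z /=; rewrite innerDl. Qed.
Next Obligation. by move=> k x y /=; rewrite innerZr. Qed.
Next Obligation. by move=> k x y /=; rewrite innerZl. Qed.
Next Obligation. exact: nm_inner. Qed.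
Next Obligation. exact: inner_norm_le. Qed.

End HilbertForm.

(** * Positive operators and positive forms *)

Section OperatorCone.
Variables (R : realType) (Alg : cstarAlgType R) (H : hilbertModType Alg).
Local Notation LH := (adjop H H).
Local Notation symop := (symop (hilbert_form H)).
Implicit Types (x y z : H) (T S : LH) (f g k : symop) (c e l s t : R).

Definition form_pos (f : H -> H) := forall x, pos (inner x (f x)).

Lemma selfadj_sym T : star T = T -> forall x y, inner (T x) y = inner x (T y).
Proof. by move=> hT x y; rewrite -{2}hT adjop_adjE. Qed.

Definition sym_of T (hT : star T = T) : symop :=
  @Symop _ _ _ (hilbert_form H) T (selfadj_sym hT).

Definition adjop_of f : LH := Adjop (symE f).

Lemma inner_symE f x y : inner (f x) y = inner x (f y).
Proof. exact: (symE f). Qed.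

Lemma star_inner_sym f x : star (inner x (f x)) = inner x (f x).
Proof. by rewrite -innerC inner_symE. Qed.

Lemma innerZr_real t x y : inner x (t%:C *: y) = t%:C *: inner x y.
Proof. exact: innerZr. Qed.

Lemma innerZl_real t x y : inner (t%:C *: x) y = t%:C *: inner x y.
Proof. by rewrite innerZl conj_rc. Qed.

Lemma innerNr x y : inner x (- y) = - inner x y.
Proof. by rewrite -scaleN1r innerZr scaleN1r. Qed.

Lemma innerNl x y : inner (- x) y = - inner x y.
Proof. by rewrite -scaleN1r innerZl rmorphN1 scaleN1r. Qed.

(** f + e = k^2 gives <x, f x> + e <x, x> = <k x, k x>. *)
Lemma accretive_form_pos f : accretive f -> form_pos f.
Proof.
move=> [s s0 hs] x; apply: (pos_lim (K := nm x ^+ 2)).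
- by rewrite exprn_ge0 // nm_ge0.
- exact: star_inner_sym.
move=> e e0 e1; have [k [kk _]] := sqrt_shift s0 hs e0.
exists (inner (k x) (k x)); first exact: inner_pos.
rewrite inner_symE kk innerDr innerZr_real opprD addrA subrr add0r nmN nmZ.
by rewrite nm_inner (ger0_norm (ltW e0)).
Qed.

(** c f (c - f) = f (c - f) f + (c - f) f (c - f). *)
Lemma form_pos_logistic f c : 0 < c -> bnd f c -> form_pos f ->
  form_pos (fun x => f (c%:C *: x - f x)).
Proof.
move=> c0 hc hf x.
pose d := scomb c (sone _) (-1) f : symop.
have dE y : d y = c%:C *: y - f y by rewrite /= rmorphN1 scaleN1r.
have hd : form_pos d.
  apply: accretive_form_pos; exists c; first exact: ltW.
  by apply: disc_ext (bnd_shift hc) => y; rewrite dE.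
have -> : inner x (f (c%:C *: x - f x)) =
    (c^-1)%:C *: (inner (f x) (d (f x)) + inner (d x) (f (d x))).
  rewrite !dE !sym_lin !(innerDl, innerDr, innerNr, innerNl, innerZr_real, innerZl_real).
  rewrite !inner_symE; lmodule_eq R[i]; field; by rewrite fmorph_eq0 gt_eqF.
by apply: pos_scale; [rewrite invr_ge0 ltW | apply: pos_add].
Qed.

(** With 0 <= f <= M, the map d = M - f satisfies
    M^2 - d^2 = f (2M - f) >= 0, so |d x|^2 = |<d x, d x>| <= M^2 |x|^2. *)
Lemma form_pos_accretive f : form_pos f -> accretive f.
Proof.
move=> hf; have [M M0 hM] := sym_bounded f.
exists M; first exact: ltW.
pose d := scomb M (sone _) (-1) f : symop.
have dE y : d y = M%:C *: y - f y by rewrite /= rmorphN1 scaleN1r.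
move=> x; rewrite -dE -ler_sqr ?nnegrE ?mulr_ge0 ?nm_ge0 ?(ltW M0) //.
rewrite exprMn -!nm_inner.
have M20 : 0 <= M ^+ 2 by rewrite exprn_ge0 // ltW.
rewrite -(ger0_norm M20) -nmZ; apply: pos_norm; first exact: inner_pos.
have M2 : 0 < 2 * M by lra.
have hM2 : bnd f (2 * M) by apply: bndW hM; lra.
have := form_pos_logistic M2 hM2 hf x; congr pos.
rewrite !dE !sym_lin !(innerDl, innerDr, innerNr, innerNl, innerZr_real, innerZl_real).
rewrite !inner_symE; lmodule_eq R[i]; ring.
Qed.

Lemma positive_form_pos T : positive T -> star T = T /\ form_pos T.
Proof.
move=> [hT sp]; split=> //; apply: (accretive_form_pos (f := sym_of hT)).
apply: accretive_of_shifts => l l0.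
have l0' : - l%:C != 0 :> R[i] by rewrite oppr_eq0 fmorph_eq0 gt_eqF.
have [S [S1 S2]] : exists S : LH,
    S ** (- l%:C *: adjop_id H - T) = adjop_id H /\
    (- l%:C *: adjop_id H - T) ** S = adjop_id H.
  apply: contrapT => /(spectrum_adjop T l0') /sp.
  by rewrite oppr_ge0 -(rmorph0 (real_complex R)) lecR leNgt l0.
exists (fun x => - S x); split=> x /=.
  have /= e := congr1 (fun U : LH => U x) S2.
  rewrite -[RHS]e -(scaleN1r (S x)) adjop_is_scalable.
  by lmodule_eq R[i]; ring.
have /= e := congr1 (fun U : LH => U x) S1.
rewrite -[RHS]e -scaleN1r -adjop_is_scalable; congr (S _).
by lmodule_eq R[i]; ring.
Qed.

(** A negative spectral value -l is excluded by the inverse of T + l.  For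
    l = a + ib with b nonzero, (T - l) (T - l') = (T - a)^2 + b^2, where l' is the
    conjugate, and this is invertible because squares are accretive. *)
Lemma form_pos_positive T : star T = T -> form_pos T -> positive T.
Proof.
move=> hT hp; split=> // l sl.
pose f := sym_of hT; have fT x : f x = T x by [].
have fa : accretive f by exact: form_pos_accretive.
have [->|l0] := eqVneq l 0; first exact: lexx.
move: sl => /(spectrum_adjop T l0) nS; apply: contrapT => nl; apply: nS.
case: l l0 nl => a b l0 nl.
have [b0|b0] := eqVneq b 0.
  subst b; have a0 : 0 < - a.
    by rewrite oppr_gt0 ltNge; apply/negP => a0; apply: nl; rewrite ler0c.
  have [S [S1 S2]] := accretive_shift_inverse fa a0.
  exists (- adjop_of S); split; apply: adjopP => x /=.
    rewrite -[RHS]S2 -symN; congr (S _); rewrite fT rmorphN complexr0.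
    by lmodule_eq R[i]; ring.
  rewrite -[RHS]S1 !fT -(scaleN1r (S x)) adjop_is_scalable rmorphN complexr0.
  by lmodule_eq R[i]; ring.
pose g := scomb 1 f (- a) (sone _) : symop.
have gE x : g x = T x - a%:C *: x.
  by rewrite /= scale1r rmorphN scaleNr.
have ga : accretive (ssq g).
  have [M M0 hM] := sym_bounded g.
  by exists (M ^+ 2); [rewrite exprn_ge0 // ltW | apply: disc_sq => //; exact: ltW].
have b2 : 0 < b ^+ 2 by rewrite exprn_even_gt0.
have [S [S1 S2]] := accretive_shift_inverse ga b2.
set l := a +i* b; set l' := a -i* b.
have ll : l + l' = a%:C + a%:C.
  by apply/eqP; rewrite eq_complex /= subrr addr0 !eqxx.
have lm : l * l' = (a ^+ 2 + b ^+ 2)%:C.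
  by apply/eqP; rewrite eq_complex /=; apply/andP; split; apply/eqP; ring.
pose U (u : R[i]) x := u *: x - T x.
have TB x y : T (x - y) = T x - T y.
  by rewrite -scaleN1r adjop_is_additive adjop_is_scalable scaleN1r.
have TL := (TB, @adjop_is_scalable _ _ _ _ T).
have UU x : U l (U l' x) = ssq g x + (b ^+ 2)%:C *: x.
  rewrite /U -[ssq g x]/(g (g x)) !gE !TL.
  transitivity ((l * l') *: x - (l + l') *: T x + T (T x)).
    by lmodule_eq R[i]; ring.
  by rewrite ll lm; lmodule_eq R[i]; ring.
have UC x : U l' (U l x) = U l (U l' x).
  by rewrite /U !TL; lmodule_eq R[i]; ring.
have US x : U l (U l' (S x)) = x by rewrite UU S1.
have SU x : S (U l (U l' x)) = x by rewrite UU S2.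
exists (((l' *: adjop_id H) - T) *o adjop_of S); split; apply: adjopP => x /=.
  rewrite -/(U l x) -/(U l' (S (U l x))).
  have -> : U l' (S (U l x)) = S (U l' (U l (U l' (S (U l x))))).
    by rewrite UC SU.
  by rewrite US UC SU.
by rewrite -/(U l' (S x)) -/(U l (U l' (S x))) US.
Qed.

End OperatorCone.

(** * Orthogonal projections *)

Section Projection.
Variables (R : realType) (Alg : cstarAlgType R) (H : hilbertModType Alg).
Implicit Types (x y z : H) (M : set H).

Lemma inner_eq0C x y : inner x y = 0 -> inner y x = 0.
Proof.
move=> e; rewrite innerC e.
by have := starZ (0 : R[i]) (0 : Alg); rewrite rmorph0 !scale0r.
Qed.

Lemma closure_nm M x : closure M x ->
  forall e : R, 0 < e -> exists2 y, M y & nm (x - y) < e.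
Proof.
move=> cx e e0.
have : nbhs x (ball x (e%:C)) by apply: nbhsx_ballx; rewrite ltcR.
move/cx => [y [My]]; rewrite -ball_normE /= nmE ltcR => xy.
by exists y.
Qed.

Lemma orthocomp_closure M a x : (forall y, M y -> inner a y = 0) ->
  closure M x -> inner a x = 0.
Proof.
move=> h cx; apply: nm_le0; apply: (@le_eps _ _ _ (nm a)) => e e0 _.
have [y My xy] := closure_nm cx e0.
rewrite add0r -(subr0 (inner a x)) -(h y My) -innerNr -innerDr mulrC.
apply: le_trans (inner_norm_le _ _) _.
by rewrite ler_wpM2l ?nm_ge0 // ltW.
Qed.

(** Symmetry of x |-> P x follows from the two orthogonality relations alone, and
    carries linearity with it. *)
Lemma orthogonal_projection M : orthogonally_complemented M ->
  exists P : symop (hilbert_form H),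
    [/\ forall x, M (P x), forall x y, M y -> inner (x - P x) y = 0 &
        forall x, M x -> P x = x].
Proof.
move=> [dec _].
have /choice [P hP] : forall x, exists m, M m /\ orthocomp M (x - m).
  move=> x; have [m [n [Mm Mn ->]]] := dec x; exists m; split=> //.
  by rewrite addrC addKr.
have PM x : M (P x) by case: (hP x).
have PN x y : M y -> inner (x - P x) y = 0 by case: (hP x) => _; apply.
have PE x y : inner (P x) y = inner (P x) (P y).
  apply/eqP; rewrite -subr_eq0 -innerNr -innerDr; apply/eqP.
  exact/inner_eq0C/PN.
have symP x y : inner (P x) y = inner x (P y).
  by rewrite PE innerC -PE -innerC.
exists (@Symop _ _ _ (hilbert_form H) P symP); split=> // x Mx /=.
apply/esym/eqP; rewrite -subr_eq0; apply/eqP/inner_eq0.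
by rewrite innerDr innerNr !PN // subrr.
Qed.

End Projection.

(** * The operator equation *)

Section Solution.
Variables (R : realType) (Alg : cstarAlgType R) (H K : hilbertModType Alg).
Variables A C : adjop H K.

Lemma adjop_sub (H1 H2 : hilbertModType Alg) (T : adjop H1 H2) x y :
  T (x - y) = T x - T y.
Proof. by rewrite -scaleN1r adjop_is_additive adjop_is_scalable scaleN1r. Qed.

Lemma inner_adj (H1 H2 : hilbertModType Alg) (T : adjop H1 H2) x y :
  inner (adj T y) x = inner y (T x).
Proof. exact: (adjop_adjE (adj T)). Qed.

(** The form of t CA* - CC* at y is the form of X (t - X) at A* y. *)
Lemma solvable_necessary (X : adjop H H) : positive X -> A *o X = C ->
  range C `<=` range A /\
  exists t : R, 0 < t /\ herm_le (C *o adj C) (t%:C *: (C *o adj A)).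
Proof.
move=> pX AX; have [hX fX] := positive_form_pos pX.
have XE x : adj X x = X x by rewrite -[in RHS]hX.
have CE x : C x = A (X x) by rewrite -AX.
have C'E y : adj C y = X (adj A y) by rewrite -AX /= -XE.
split; first by move=> _ [x _ <-]; exists (X x) => //; rewrite CE.
have [t t0 ht] := sym_bounded (sym_of hX).
exists t; split=> //.
have h1 : star (C *o adj C) = C *o adj C by apply: adjopP.
have h2 : star (t%:C *: (C *o adj A)) = t%:C *: (C *o adj A).
  apply: adjopP => y /=.
  by rewrite conj_rc -[adjop_adj C y]/(adj C y) C'E CE.
split=> //; apply: form_pos_positive.
  by rewrite /Defs.hermitian starD h2 starN h1.
move=> y; have := form_pos_logistic t0 ht fX (adj A y).
congr pos; rewrite inner_adj /=; congr inner.
rewrite -[adjop_adj C y]/(adj C y) C'E !CE.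
by rewrite !(adjop_sub, adjop_is_scalable).
Qed.

Variables (t : R) (t0 : 0 < t).
Hypothesis rangeCA : range C `<=` range A.
Hypothesis leCA : herm_le (C *o adj C) (t%:C *: (C *o adj A)).

Let M := closure (range (adj A)).

Lemma CA_sym y : C (adj A y) = A (adj C y).
Proof.
case: leCA => _ h _; have /= := congr1 (fun U : adjop K K => U y) h.
rewrite conj_rc => /scalerI -> //; by rewrite fmorph_eq0 gt_eqF.
Qed.

Lemma CA_pos y : pos (inner (adj C y) (t%:C *: adj A y - adj C y)).
Proof.
case: leCA => _ _ /positive_form_pos [_ /(_ y)] /=; congr pos.
by rewrite inner_adj adjop_sub adjop_is_scalable.
Qed.

(** |C* y|^2 = |<y, CC* y>| <= t |<C* y, A* y>| <= t |C* y| |A* y|. *)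
Lemma adjC_le y : nm (adj C y) <= t * nm (adj A y).
Proof.
have := pos_norm (inner_pos (adj C y)) (b := inner (adj C y) (t%:C *: adj A y)).
rewrite -innerNr -innerDr => /(_ (CA_pos y)).
rewrite nm_inner => /le_trans /(_ (inner_norm_le _ _)).
rewrite nmZ (ger0_norm (ltW t0)) expr2.
have [c0|c0] := leP (nm (adj C y)) 0; last by rewrite ler_pM2l.
by move=> _; apply: le_trans c0 _; rewrite mulr_ge0 ?nm_ge0 // ltW.
Qed.

Section WithProjection.
Variable P : symop (hilbert_form H).
Hypothesis PM : forall x, M (P x).
Hypothesis PN : forall x y, M y -> inner (x - P x) y = 0.
Hypothesis PK : forall x, M x -> P x = x.

Arguments PM : clear implicits.

Lemma adjA_M y : M (adj A y).
Proof. by apply: subset_closure; exists y. Qed.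

Lemma A_P x : A (P x) = A x.
Proof.
apply/esym/inner_inj => y; rewrite !adjop_adjE; apply/eqP; rewrite -subr_eq0.
by rewrite -innerNl -innerDl PN //; exact: adjA_M.
Qed.

Lemma A_P0 x : A (x - P x) = 0.
Proof. by rewrite adjop_sub A_P subrr. Qed.

(** The value at z of the continuous extension of A* y |-> C* y to M, composed
    with P. *)
Lemma reduced_adjoint_value z : exists l, forall y,
  nm (l - adj C y) <= t * nm (P z - adj A y).
Proof.
have r0 : (0:R) <= 2^-1 by lra.
have r1 : 2^-1 < 1 :> R by lra.
have /choice [y hy] : forall n : nat, exists y, nm (P z - adj A y) <= 2^-1 ^+ n.
  move=> n; have [|_ [y _ <-] h] := closure_nm (PM z) (e := 2^-1 ^+ n).
    by rewrite exprn_gt0 // invr_gt0.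
  by exists y; exact: ltW.
have du n : nm (adj C (y n.+1) - adj C (y n)) <= (t * 2) * 2^-1 ^+ n.
  rewrite -adjop_sub; apply: le_trans (adjC_le _) _; rewrite -mulrA ler_wpM2l ?(ltW t0) //.
  rewrite adjop_sub.
  have -> : adj A (y n.+1) - adj A (y n) = (P z - adj A (y n)) - (P z - adj A (y n.+1)).
    by lmodule_eq R[i]; ring.
  apply: le_trans (nmB _ _) _; have := hy n; have := hy n.+1; rewrite exprS.
  have : (0:R) <= 2^-1 ^+ n by rewrite exprn_ge0.
  lra.
have [l hl] := geometric_cvg r0 r1 du.
exists l => w; rewrite -subr_le0.
apply: (geo_le0 (c := t * 2 / (1 - 2^-1) + t) r0 r1) => n.
have -> : l - adj C w = (l - adj C (y n)) + (adj C (y n - w)).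
  by rewrite adjop_sub; lmodule_eq R[i]; ring.
have h1 := hl n; have h2 := adjC_le (y n - w); rewrite (adjop_sub (adj A)) in h2.
have h3 := nmD (l - adj C (y n)) (adj C (y n - w)).
have h4 : nm (adj A (y n) - adj A w) <= nm (P z - adj A w) + 2^-1 ^+ n.
  have -> : adj A (y n) - adj A w = (P z - adj A w) - (P z - adj A (y n)).
    by lmodule_eq R[i]; ring.
  by apply: le_trans (nmB _ _) _; rewrite lerD2l.
rewrite lerBlDr; apply: le_trans h3 _; rewrite mulrDl -addrA; apply: lerD => //.
rewrite -mulrDr [X in _ <= _ * X]addrC; apply: le_trans h2 _.
by rewrite ler_wpM2l // ltW.
Qed.

(** The equality <D x, z> = <x, E z> holds for z = A* y, where both sides are
    <C x, y>, and passes to the limit on M. *)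
Lemma reduced_solution : exists D : adjop H H,
  [/\ forall x, M (D x), forall x, A (D x) = C x &
      forall z y, nm (adj D z - adj C y) <= t * nm (P z - adj A y)].
Proof.
have /choice [D hD] : forall x, exists m, M m /\ A m = C x.
  move=> x; have [z _ zE] : range A (C x) by apply: rangeCA; exists x.
  by exists (P z); rewrite A_P.
have /choice [E hE] := reduced_adjoint_value.
have DE x z : inner (D x) z = inner x (E z).
  apply/eqP; rewrite -subr_eq0; apply/eqP/nm_le0.
  apply: (@le_eps _ _ _ (nm (D x) + nm x * t)) => e e0 _.
  have [_ [y _ <-] /ltW hy] := closure_nm (PM z) e0.
  have -> : inner (D x) z - inner x (E z) =
      inner (D x) (P z - adj A y) - inner x (E z - adj C y).
    rewrite !innerDr !innerNr -(adjop_adjE C) -(adjop_adjE A) (proj2 (hD x)).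
    have : inner (z - P z) (D x) = 0 by apply: PN; case: (hD x).
    rewrite innerDl innerNl => /eqP; rewrite subr_eq0 => /eqP e1.
    by rewrite (innerC z) e1 -innerC; lmodule_eq R[i]; ring.
  rewrite add0r; apply: le_trans (nmB _ _) _; rewrite mulrDr; apply: lerD.
    apply: le_trans (inner_norm_le _ _) _; rewrite mulrC.
    by rewrite ler_wpM2r ?nm_ge0.
  apply: le_trans (inner_norm_le _ _) _; rewrite [leRHS]mulrCA ler_wpM2l ?nm_ge0 //.
  apply: le_trans (hE z y) _.
  by rewrite mulrC ler_wpM2r ?(ltW t0).
exists (Adjop DE); split=> [x|x|] //=; by case: (hD x).
Qed.

(** The solution is X = D + Q E + t Q, where E = D*. *)
Lemma solvable_sufficient : exists X : adjop H H, positive X /\ A *o X = C.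
Proof.
have [D [DM AD DE]] := reduced_solution.
set E := adj D in DE.
have EA y : E (adj A y) = adj C y.
  apply/eqP; rewrite -subr_eq0; apply/eqP/nm_le0.
  by apply: le_trans (DE _ y) _; rewrite PK ?subrr ?nm0 ?mulr0 //; exact: adjA_M.
have DEi x z : inner (D x) z = inner x (E z) by exact: adjop_adjE.
have EDi x z : inner (E x) z = inner x (D z) by exact: inner_adj.
have Pi x z : inner (P x) z = inner x (P z) by exact: (symE P).
have EP z : E (P z) = E z.
  by apply: inner_inj => x; rewrite !EDi Pi PK.
have Ele u : nm (E u) <= t * nm (P u).
  by have := DE u 0; rewrite -(subrr 0) !adjop_sub !subrr !subr0.
(* Both <D u, v> and <E u, v> are <C A* y, w> at u = A* y, v = A* w; density is
   used in v and then in u, each time in the argument outside D and E. *)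
have DM_sym u v : M u -> M v -> inner (D u) v = inner (E u) v.
  have zero y : forall v, M v -> inner (D (adj A y) - E (adj A y)) v = 0.
    move=> {}v; apply: orthocomp_closure => _ [w _ <-].
    by rewrite innerDl innerNl EA -!adjop_adjE AD -CA_sym subrr.
  move=> Mu Mv; apply/eqP; rewrite -subr_eq0 DEi EDi -innerNr -innerDr; apply/eqP.
  apply/inner_eq0C/(orthocomp_closure _ Mu) => _ [y _ <-]; apply: inner_eq0C.
  rewrite innerDr innerNr -DEi -EDi -innerNl -innerDl; exact: zero.
have PE x : D (P x) = P (E x).
  by apply: inner_inj => z; rewrite -[in LHS](PK (DM (P x))) !Pi DM_sym // EP.
pose Q x := x - P x.
have Qi x z : inner (Q x) z = inner x (Q z).
  by rewrite innerDl innerNl Pi -innerNr -innerDr.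
pose X0 x := D x + Q (E x) + t%:C *: Q x.
have X0sym x z : inner (X0 x) z = inner x (X0 z).
  have h : inner x (D (P z)) = inner (D (P x)) z by rewrite -EDi -Pi -PE.
  rewrite /X0 /Q !(innerDl, innerDr, innerNl, innerNr, innerZl_real, innerZr_real).
  rewrite -!PE h (DEi x z) (EDi x z) Pi.
  by lmodule_eq R[i]; ring.
have XS : star (Adjop X0sym) = Adjop X0sym by apply: adjopP.
exists (Adjop X0sym); split; last first.
  apply: adjopP => x /=; rewrite /X0 /Q.
  by rewrite 2!adjop_is_additive adjop_is_scalable !A_P0 AD scaler0 !addr0.
apply: form_pos_positive => // x /=.
have ED u : M u -> inner (E u) u = inner u (E u).
  by move=> Mu; rewrite EDi -DEi DM_sym.
(* On M, G is the form of t D - D D*; E is used in place of D because [EleM] bounds it. *)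
pose L u := t%:C *: u - E u.
have LE u v : L (u - v) = L u - L v.
  by rewrite /L adjop_sub; lmodule_eq R[i]; ring.
pose G u := inner (E u) (L u).
have GA y : pos (G (adj A y)) by rewrite /G /L EA; exact: CA_pos.
have EleM u : M u -> nm (E u) <= t * nm u by move=> Mu; rewrite -{2}(PK Mu).
have LleM u : M u -> nm (L u) <= 2 * t * nm u.
  move=> Mu; apply: le_trans (nmB _ _) _; rewrite nmZ (ger0_norm (ltW t0)).
  have := EleM u Mu; lra.
have MB u v : M u -> M v -> M (u - v).
  by move=> Mu Mv; rewrite -(PK Mu) -(PK Mv) -symN -symD.
have Gpos u : M u -> pos (G u).
  move=> Mu; pose k := t * (2 * t * nm u) + t * (nm u + 1) * (2 * t).
  have k0 : 0 <= k.
    by rewrite /k addr_ge0 ?mulr_ge0 ?addr_ge0 ?nm_ge0 ?(ltW t0).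
  apply: (pos_lim k0).
    rewrite /G /L innerDr innerNr innerZr_real starD starN starZ_real.
    by rewrite -!innerC ED.
  move=> e e0 e1; have [_ [y _ <-] /ltW hy] := closure_nm Mu e0.
  exists (G (adj A y)) => //; set v := adj A y in hy *.
  have Mv : M v by exact: adjA_M.
  have -> : G u - G v = inner (E (u - v)) (L u) + inner (E v) (L (u - v)).
    rewrite /G LE adjop_sub (innerDl (E u)) innerNl (innerDr (E v) (L u)) innerNr.
    by lmodule_eq R[i]; ring.
  have nv : nm v <= nm u + 1.
    have -> : v = u - (u - v) by lmodule_eq R[i]; ring.
    by apply: le_trans (nmB _ _) _; rewrite lerD2l (le_trans hy).
  have hE : nm (E (u - v)) <= t * e.
    by apply: le_trans (EleM _ (MB _ _ Mu Mv)) _; rewrite ler_wpM2l // ltW.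
  have hL : nm (L (u - v)) <= 2 * t * e.
    by apply: le_trans (LleM _ (MB _ _ Mu Mv)) _; rewrite ler_wpM2l // mulr_ge0 // ltW.
  have hEv : nm (E v) <= t * (nm u + 1).
    by apply: le_trans (EleM _ Mv) _; rewrite ler_wpM2l // ltW.
  apply: le_trans (nmD _ _) _.
  have -> : e * k = t * e * (2 * t * nm u) + t * (nm u + 1) * (2 * t * e).
    by rewrite /k; ring.
  apply: lerD; apply: le_trans (inner_norm_le _ _) _; apply: ler_pM; rewrite ?nm_ge0 //.
  exact: LleM.
(* t X = P (t D - D D* ) P + (D + t Q) (D + t Q)*, evaluated as a form at x. *)
have -> : inner x (X0 x) =
   (t^-1)%:C *: (G (P x) + inner (E x + t%:C *: Q x) (E x + t%:C *: Q x)).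
  have QQ : inner (Q x) (Q x) = inner x (Q x).
    by rewrite Qi /Q symD symN (PK (PM x)) subrr subr0.
  have EQ : inner (E x) (Q x) = inner x (D x) - inner (E x) (P x).
    by rewrite /Q innerDr innerNr EDi.
  have XE : inner x (X0 x) = inner x (D x) + inner (Q x) (E x) + t%:C *: inner x (Q x).
    rewrite /X0 (innerDr x (D x + Q (E x))) (innerDr x (D x)) innerZr_real.
    by rewrite -(Qi x (E x)).
  have GE : G (P x) = t%:C *: inner (E x) (P x) - inner (E x) (E x).
    by rewrite /G /L EP innerDr innerNr innerZr_real.
  rewrite XE GE; move: (Q x) QQ EQ => q QQ EQ.
  rewrite !(innerDl, innerDr, innerZl_real, innerZr_real) QQ EQ.
  by lmodule_eq R[i]; field; rewrite fmorph_eq0 gt_eqF.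
apply: pos_scale; first by rewrite invr_ge0 ltW.
by apply: pos_add; [exact/Gpos/PM|exact: inner_pos].
Qed.

End WithProjection.
End Solution.

Theorem theorem2p14 (R : realType) (Alg : cstarAlgType R)
    (H K : hilbertModType Alg) (A C : adjop H K) :
  semi_regular A ->
  (exists X : adjop H H, positive X /\ A *o X = C) <->
  (range C `<=` range A /\
   exists t : R, 0 < t /\
     herm_le (C *o adj C) (t%:C *: (C *o adj A))).
Proof.
move=> [_ /orthogonal_projection [P [PM PN PK]]]; split.
  by move=> [X [pX AX]]; exact: solvable_necessary pX AX.
by move=> [rCA [t [t0 le]]]; exact: (solvable_sufficient t0 rCA le PM PN PK).
Qed.
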